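(* (a) There exists a residual set $\mathcal{T}_1\subset\mathcal{S}$ such that for every $\gamma\in\mathcal{T}_1$ no periodic symplectic billiard orbit in $\gamma$ passes, within one period, through the same boundary point more than once; that is, if $\{(t_1,s_1),\ldots,(t_n,s_n)\}$ is a periodic orbit of $T_\gamma$ with least period $n$, then the points $\gamma(t_1),\ldots,\gamma(t_n)$ are pairwise distinct. (b) There exists a residual set $\mathcal{T}_2\subset\mathcal{S}$ such that for every $\gamma\in\mathcal{T}_2$ any two distinct periodic symplectic billiard orbits in $\gamma$ have no common reflection points.
   Context: Tables. Let $\mathbb{S}=\mathbb{R}/2\pi\mathbb{Z}$. $\mathcal{S}$ denotes the set of strongly convex planar billiard tables with $C^\infty$ boundary; a table is identified with a $C^\infty$ regular injective parametrization $\gamma:\mathbb{S}\to\mathbb{R}^2$ of its boundary $\Gamma=\gamma(\mathbb{S})$, which is oriented counterclockwise and has everywhere strictly positive curvature. $\mathcal{S}$ carries the Whitney $C^\infty$ topology: $\gamma_m\to\gamma$ iff $\|\gamma_m-\gamma\|_{C^k}\to0$ for every $k\ge0$. With it $\mathcal{S}$ is a Baire space. A subset of $\mathcal{S}$ is residual if it contains a countable intersection of open dense subsets. Symplectic billiard. For $t\in\mathbb{S}$, $t^*\ne t$ is the unique parameter with $\det(\gamma'(t),\gamma'(t^* ))=0$. The phase space is $\hat{\mathcal{P}}_\gamma=\{(\gamma(t_1),\gamma(t_2)): t_1<t_2<t_1^*\}$ (cyclic counterclockwise order: $\gamma(t_2)$ lies in the open arc going counterclockwise from $\gamma(t_1)$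 to $\gamma(t_1^* )$). The symplectic billiard map is $\hat T_\gamma(\gamma(t_1),\gamma(t_2))=(\gamma(t_2),\gamma(t_3))$, where $\gamma(t_3)$ is the unique point of $\Gamma$ with $(\gamma(t_2),\gamma(t_3))\in\hat{\mathcal{P}}_\gamma$ and $\det(\gamma'(t_2),\gamma(t_3)-\gamma(t_1))=0$. Coordinates. Fix an origin $O$ in the interior of the table, let $L(t_1,t_2)=\det(\gamma(t_1)-O,\gamma(t_2)-O)$ and let $L_1,L_2$ be its partial derivatives in the first and second variable. Then $(t_1,s_1)$ with $s_1=-L_1(t_1,t_2)$ are coordinates on the phase space, which becomes $\mathcal{P}_\gamma=\{(t,s): -L_1(t,t^* )<s<-L_1(t,t)\}\subset\mathbb{S}\times\mathbb{R}$; in them the map is $T_\gamma:\mathcal{P}_\gamma\to\mathcal{P}_\gamma$, $(t_1,-L_1(t_1,t_2))\mapsto(t_2,L_2(t_1,t_2))$, and $L_2(t_1,t_2)=-L_1(t_2,t_3)$. A periodic orbit of $T_\gamma$ (also called a periodic orbit in $\gamma$) of period $n$ is a set $\{(t_1,s_1),\ldots,(t_n,s_n)\}\subset\mathcal{P}_\gamma$ with $T_\gamma(t_i,s_i)=(t_{i+1},s_{i+1})$, $(t_{n+1},s_{n+1})=(t_1,s_1)$, where $n$ is the least period. Its reflection points are $\gamma(t_1),\ldots,\gamma(t_n)$. *)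

(* Defs.v *)
From HB Require Import structures.
From mathcomp Require Import all_boot all_order all_algebra.
From mathcomp Require Import ring.
From mathcomp Require Import all_classical all_reals all_analysis.
Set Implicit Arguments.
Unset Strict Implicit.
Unset Printing Implicit Defensive.
Import Order.TTheory GRing.Theory Num.Theory.
Import numFieldNormedType.Exports.
Local Open Scope ring_scope.
Local Open Scope classical_set_scope.

(* A parametrization of a closed curve is a 2pi-periodic map R -> R * R, and  *)
(* a point of the circle R / 2pi Z is represented by its unique               *)
(* representative in `[0, 2pi[.                                               *)

Definition residual (T : topologicalType) (A : set T) : Prop :=
  exists G : nat -> set T,
    (forall n, open (G n) /\ dense (G n)) /\ \bigcap_n G n `<=` A.

Section Plane.
Context {R : realType}.

Definition det2 (u v : R * R) : R := u.1 * v.2 - u.2 * v.1.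

Definition enorm (u : R * R) : R := Num.sqrt (u.1 ^+ 2 + u.2 ^+ 2).

Definition circle : set R := [set` `[0, 2 * pi[%R].

(* t1 < t2 < t3 in the counterclockwise cyclic order, for representatives     *)
(* in `[0, 2pi[.                                                              *)
Definition cyclic_lt (t1 t2 t3 : R) : bool :=
  [|| t1 < t2 < t3, t2 < t3 < t1 | t3 < t1 < t2].

(* Signed: positive when the curve turns left. *)
Definition curvature (g : R -> R * R) (t : R) : R :=
  det2 (g^`() t) (g^`(2) t) / enorm (g^`() t) ^+ 3.

(* For a convex curve run counterclockwise, the closed region that it bounds  *)
(* is the intersection of the closed half-planes to the left of its tangents. *)
Definition region (g : R -> R * R) : set (R * R) :=
  [set x | forall t, 0 <= det2 (g^`() t) (x - g t)].

(* [table_region] says that the curve lies to the left of each of its         *)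
(* oriented tangent lines: the table is convex and its boundary is oriented   *)
(* counterclockwise.                                                          *)
Record is_table (g : R -> R * R) : Prop := IsTable {
  table_smooth : forall k t, derivable g^`(k) t 1 ;
  table_periodic : forall t, g (t + 2 * pi) = g t ;
  table_regular : forall t, g^`() t != 0 ;
  table_injective : {in circle &, injective g} ;
  table_region : range g `<=` region g ;
  table_curvature : forall t, 0 < curvature g t }.

(* `|.| is the max norm of R * R, which is equivalent to the Euclidean one.   *)
(* Meant for smooth periodic h, for which the suprema are finite.             *)
Definition Cknorm (k : nat) (h : R -> R * R) : R :=
  \big[Num.max/0]_(j < k.+1) sup (range (fun t => `|h^`(j) t|)).

Lemma Cknorm_le (j k : nat) (h : R -> R * R) :
  (j <= k)%N -> Cknorm j h <= Cknorm k h.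
Proof.
move=> jk; apply/bigmax_leP; split=> [|i _].
  by rewrite /Cknorm; apply: bigmax_ge_id.
have ik : (i < k.+1)%N by rewrite (leq_trans (ltn_ord i)).
exact: (le_bigmax _ (fun i : 'I_k.+1 => sup (range (fun t => `|h^`(i) t|)))
  (Ordinal ik)).
Qed.

End Plane.

Record table (R : realType) := Table {
  curve :> R -> R * R ;
  tableP : is_table curve }.

HB.instance Definition _ (R : realType) := gen_eqMixin (table R).
HB.instance Definition _ (R : realType) := gen_choiceMixin (table R).

Section WhitneyTopology.
Context {R : realType}.

Definition Ckball (g : table R) (k : nat) (e : R) : set (table R) :=
  [set h | Cknorm k (fun t => h t - g t) < e].

(* Topology of uniform convergence of all the derivatives. *)
Definition Cinfty_open : set_system (table R) :=
  [set U | forall g, U g -> exists k e, 0 < e /\ Ckball g k e `<=` U].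

Lemma Cinfty_openT : Cinfty_open setT.
Proof. by move=> g _; exists 0%N, 1. Qed.

Lemma Cinfty_openI : setI_closed Cinfty_open.
Proof.
move=> U V oU oV g [/oU [k [e [e0 keU]]] /oV [l [d [d0 ldV]]]].
exists (maxn k l), (Num.min e d); split; first by rewrite lt_min e0.
move=> h; rewrite /Ckball /= lt_min => /andP[he hd]; split.
  apply: keU; apply: le_lt_trans he; exact/Cknorm_le/leq_maxl.
apply: ldV; apply: le_lt_trans hd; exact/Cknorm_le/leq_maxr.
Qed.

Lemma Cinfty_open_bigU (I : Type) (f : I -> set (table R)) :
  (forall i, Cinfty_open (f i)) -> Cinfty_open (\bigcup_i f i).
Proof.
move=> of_ g [i _ /of_ [k [e [e0 ke]]]]; exists k, e; split=> // h /ke fh.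
by exists i.
Qed.

End WhitneyTopology.

HB.instance Definition _ (R : realType) :=
  isOpenTopological.Build (table R)
    Cinfty_openT Cinfty_openI Cinfty_open_bigU.

Section SymplecticBilliard.
Context {R : realType}.
Variable g : table R.

(* s = t^* *)
Definition is_star (t s : R) : Prop :=
  [/\ circle s, s != t & det2 (g^`() t) (g^`() s) = 0].

(* The phase space, with boundary points given by their parameters. *)
Definition chord_phase (t1 t2 : R) : Prop :=
  [/\ circle t1, circle t2 & exists2 s, is_star t1 s & cyclic_lt t1 t2 s].

(* Graph of the billiard map (t1, t2) |-> (t2, t3). *)
Definition chord_map (t1 t2 t3 : R) : Prop :=
  [/\ chord_phase t1 t2, chord_phase t2 t3
    & det2 (g^`() t2) (g t3 - g t1) = 0].

Variable O : R * R.

Definition genL (t1 t2 : R) : R := det2 (g t1 - O) (g t2 - O).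

Definition genL1 (t1 t2 : R) : R := derive1 (genL^~ t2) t1.

Definition genL2 (t1 t2 : R) : R := derive1 (genL t1) t2.

Definition phase : set (R * R) :=
  [set p | circle p.1 /\ exists2 s, is_star p.1 s &
     - genL1 p.1 s < p.2 < - genL1 p.1 p.1].

Definition coords (t1 t2 : R) : R * R := (t1, - genL1 t1 t2).

(* Graph of the billiard map in the coordinates (t, s); by [chord_map_genL]   *)
(* below it is (t1, - L_1(t1, t2)) |-> (t2, L_2(t1, t2)).                     *)
Definition billiard_map (p q : R * R) : Prop :=
  exists t1 t2 t3,
    [/\ chord_map t1 t2 t3, p = coords t1 t2 & q = coords t2 t3].

(* p 0, ..., p n.-1 are the successive points of a periodic orbit, n being    *)
(* its least period. The values of p beyond n are irrelevant.                 *)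
Record periodic_orbit (n : nat) (p : nat -> R * R) : Prop := PeriodicOrbit {
  orbit_gt0 : (0 < n)%N ;
  orbit_phase : forall i, (i < n)%N -> phase (p i) ;
  orbit_map : forall i, (i < n)%N -> billiard_map (p i) (p i.+1) ;
  orbit_closed : p n = p 0%N ;
  orbit_least : forall m, (0 < m < n)%N -> p m <> p 0%N }.

Lemma is_derive_curve (t : R) :
  is_derive t 1 (fun t => (g t).1) (g^`() t).1 /\
  is_derive t 1 (fun t => (g t).2) (g^`() t).2.
Proof.
have dg : derivable g t 1 := @table_smooth R g (tableP g) 0%N t.
rewrite derive1E /derive; move: dg; rewrite /derivable.
set F := fun h : R => _; set l := lim _ => cF.
have {cF}Fl : F h @[h --> 0^'] --> l by [].
have F1 : (F h).1 @[h --> 0^'] --> l.1.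
  by move: Fl; case: (l) => l1 l2 Fl; apply: cvg_comp Fl _; exact: cvg_fst.
have F2 : (F h).2 @[h --> 0^'] --> l.2.
  by move: Fl; case: (l) => l1 l2 Fl; apply: cvg_comp Fl _; exact: cvg_snd.
by split; (apply: DeriveDef; [apply/cvg_ex; eexists; eassumption
                             | apply: cvg_lim => //]).
Qed.

Lemma genL1E (t1 t2 : R) : genL1 t1 t2 = det2 (g^`() t1) (g t2 - O).
Proof.
have [d1 d2] := is_derive_curve t1; rewrite /genL1 /genL /det2 derive1E /=.
set a := _ - O.2; set b := _ - O.1.
have -> : (fun t => ((g t).1 - O.1) * a - ((g t).2 - O.2) * b) =
    (a \*: ((fun t => (g t).1) - cst O.1)) -
    (b \*: ((fun t => (g t).2) - cst O.2)).
  by apply/funext => t; rewrite !fctE /= ![_ *: _]mulrC.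
by rewrite derive_val !subr0 ![_ *: _]mulrC.
Qed.

Lemma genL2E (t1 t2 : R) : genL2 t1 t2 = det2 (g t1 - O) (g^`() t2).
Proof.
have [d1 d2] := is_derive_curve t2; rewrite /genL2 /genL /det2 derive1E /=.
set a := _ - O.1; set b := _ - O.2.
have -> : (fun t => a * ((g t).2 - O.2) - b * ((g t).1 - O.1)) =
    (a \*: ((fun t => (g t).2) - cst O.2)) -
    (b \*: ((fun t => (g t).1) - cst O.1)).
  by apply/funext => t; rewrite !fctE.
by rewrite derive_val !subr0.
Qed.

Lemma chord_map_genL (t1 t2 t3 : R) :
  chord_map t1 t2 t3 -> genL2 t1 t2 = - genL1 t2 t3.
Proof.
move=> [_ _ h]; rewrite genL1E genL2E; apply/eqP; rewrite -subr_eq0 -h.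
by apply/eqP; rewrite /det2 /=; ring.
Qed.

End SymplecticBilliard.

Definition orbit_set (R : realType) (n : nat) (p : nat -> R * R) :
  set (R * R) := [set p i | i in `I_n].

(* Main.v *)
Require Import Defs.
From mathcomp Require Import all_boot all_order all_algebra.
From mathcomp Require Import ring lra.
From mathcomp Require Import all_classical all_reals all_analysis.
Set Implicit Arguments.
Unset Strict Implicit.
Unset Printing Implicit Defensive.
Import Order.TTheory GRing.Theory Num.Theory.
Import numFieldNormedType.Exports.
Local Open Scope ring_scope.
Local Open Scope classical_set_scope.

(** Along a periodic orbit, the reflection parameters t_i satisfy one equation
    det (g' t_i, g t_(i+1) - g t_(i-1)) = 0 for each state of the orbit. If two
    distinct states, of one orbit or of two orbits, lie over the same boundary
    point, then the parameters take m distinct values, while they satisfy at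
    least m + 1 equations. A generic table has no solution of such a system.

    For this count to be meaningful the equations must be independent under
    perturbations of g. One of the two chords reflected at the common point has
    an endpoint that is not an endpoint of the other: otherwise the two states
    would be equal, or a chord would belong to the phase space in both
    directions ([chord_phase_inj], [chord_phase_asym], [crossing_neighbours]).
    The two equations at the common point imply that these two chords are
    parallel, a condition on positions only, which is violated by moving that
    endpoint. Each of the m other equations is violated by turning the tangent
    at its own point. This makes m + 1 independent perturbations. They are
    chosen as trigonometric polynomials that almost do not interact near the m
    points, since those that turn tangents vanish at the points ([node],
    [slope], [linear_estimate]).

    The passage from independence to avoidance is a counting argument. If the
    curves with perturbation parameters x and y have solutions tau and tau' in
    a small box, then |x - y| <= A |tau - tau'| for a constant A
    ([expanding_zeros]). If every x in an (m+1)-dimensional cube had a solution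
    in the box, then the points of a fine grid of the cube would lie over
    distinct cells of a comparable grid of the m-dimensional box, and there are
    too few of those ([no_expanding_section]). So some arbitrarily small
    perturbation has no solution in the box ([perturb_away_configs]). It is
    still a table, because strong convexity is stable under C^2-small
    perturbations ([table_perturb]).

    The size of the box depends only on m and on a number k that measures the
    nondegeneracy of the solution ([radius]). Hence for each combinatorial type
    of the system, each k and each box of this size with rational centre, the
    tables without a k-nondegenerate solution in the box form a dense set,
    which is open by compactness of the box. These data are countable, and the intersection
    [generic_tables] of all these sets serves for both parts of the theorem. *)

(** * Plane vectors and plane curves *)

Section PlaneCurves.
Context {R : realType}.
Implicit Types (f g h : R -> R * R) (t s : R) (u v : R * R).

Local Notation D := (@derive1n R (R * R)%type).

Definition rot u : R * R := (- u.2, u.1).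

Lemma det2Dl u v w : det2 (u + v) w = det2 u w + det2 v w.
Proof. by rewrite /det2 /=; ring. Qed.

Lemma det2Dr u v w : det2 u (v + w) = det2 u v + det2 u w.
Proof. by rewrite /det2 /=; ring. Qed.

Lemma det2Nl u v : det2 (- u) v = - det2 u v.
Proof. by rewrite /det2 /=; ring. Qed.

Lemma det2Nr u v : det2 u (- v) = - det2 u v.
Proof. by rewrite /det2 /=; ring. Qed.

Lemma det2Zl (c : R) u v : det2 (c *: u) v = c * det2 u v.
Proof. by rewrite /det2 /= /GRing.scale /=; ring. Qed.

Lemma det2Zr (c : R) u v : det2 u (c *: v) = c * det2 u v.
Proof. by rewrite /det2 /= /GRing.scale /=; ring. Qed.

Lemma det2_le u v : `|det2 u v| <= 2 * `|u| * `|v|.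
Proof.
rewrite /det2; apply: (le_trans (ler_normB _ _)); rewrite !normrM.
have [u1 u2 v1 v2] : [/\ `|u.1| <= `|u|, `|u.2| <= `|u|,
   `|v.1| <= `|v| & `|v.2| <= `|v|].
  by rewrite ![in X in [/\ _ <= X, _ <= X, _ & _]]prod_normE
    ![in X in [/\ _, _, _ <= X & _ <= X]]prod_normE !le_max !lexx ?orbT.
have -> : 2 * `|u| * `|v| = `|u| * `|v| + `|u| * `|v| by ring.
by apply: lerD; apply: ler_pM.
Qed.

Lemma norm_rot u : `|rot u| = `|u|.
Proof. by rewrite !prod_normE /= normrN maxC. Qed.

Lemma det2_rot_ge u : `|u| ^+ 2 <= det2 u (rot u).
Proof.
rewrite /det2 /= mulrN opprK !prod_normE -!expr2.
have := sqr_ge0 u.1; have := sqr_ge0 u.2.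
by case: (leP `|u.1| `|u.2|) => _ *; rewrite real_normK ?num_real// ?lerDl ?lerDr.
Qed.

Lemma is_derive_fst f t : derivable f t 1 ->
  is_derive t 1 (fun t => (f t).1) (f^`() t).1.
Proof.
move=> df; rewrite derive1E /derive; move: df; rewrite /derivable.
set F := (fun h : R => _ *: _); set l := lim _ => cF.
have {cF}Fl : F h @[h --> 0^'] --> l by [].
have F1 : (F h).1 @[h --> 0^'] --> l.1.
  by move: Fl; case: (l) => l1 l2 Fl; apply: cvg_comp Fl _; exact: cvg_fst.
by apply: DeriveDef; [apply/cvg_ex; eexists; eassumption | apply: cvg_lim].
Qed.

Lemma is_derive_snd f t : derivable f t 1 ->
  is_derive t 1 (fun t => (f t).2) (f^`() t).2.
Proof.
move=> df; rewrite derive1E /derive; move: df; rewrite /derivable.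
set F := (fun h : R => _ *: _); set l := lim _ => cF.
have {cF}Fl : F h @[h --> 0^'] --> l by [].
have F2 : (F h).2 @[h --> 0^'] --> l.2.
  by move: Fl; case: (l) => l1 l2 Fl; apply: cvg_comp Fl _; exact: cvg_snd.
by apply: DeriveDef; [apply/cvg_ex; eexists; eassumption | apply: cvg_lim].
Qed.

Lemma is_derive_scalel (a : R -> R) (da : R) v t :
  is_derive t 1 a da -> is_derive t 1 (fun t => a t *: v) (da *: v).
Proof.
move=> [ca <-]; set l := 'D_1 a t.
have cv : (fun h : R => h^-1 *: (a (h *: (1 : R) + t) - a t)) @ 0^' --> l.
  exact: ca.
have cw : (fun h : R => h^-1 *: (a (h *: (1 : R) + t) *: v - a t *: v))
    @ 0^' --> l *: v.
  have -> : (fun h : R => h^-1 *: (a (h *: (1 : R) + t) *: v - a t *: v))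
    = (fun h : R => (h^-1 *: (a (h *: (1 : R) + t) - a t)) *: v).
    by apply/funext => h /=; rewrite -scalerBl scalerA.
  exact: cvgZr_tmp.
by apply: DeriveDef; [apply/cvg_ex; eexists; exact: cw | apply: cvg_lim].
Qed.

Definition smooth f := forall k t, derivable (D k f) t 1.

Lemma smooth_derive f k t : smooth f -> is_derive t 1 (D k f) ((D k.+1 f) t).
Proof. by move=> sf; rewrite derive1nS derive1E; apply/derivableP/sf. Qed.

Lemma smooth_cont f k : smooth f -> continuous (D k f).
Proof.
by move=> sf t; apply/differentiable_continuous/derivable1_diffP; exact: sf.
Qed.

Lemma smooth_fst f k t : smooth f ->
  is_derive t 1 (fun t => ((D k f) t).1) ((D k.+1 f) t).1.
Proof. by move=> sf; apply: is_derive_fst; exact: sf. Qed.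

Lemma smooth_snd f k t : smooth f ->
  is_derive t 1 (fun t => ((D k f) t).2) ((D k.+1 f) t).2.
Proof. by move=> sf; apply: is_derive_snd; exact: sf. Qed.

Lemma derive_eq_fun (W : normedModType R) (f f' : R -> W) :
  (forall t, is_derive t 1 f (f' t)) -> f^`() = f'.
Proof. by move=> df; apply/funext => t; rewrite derive1E; apply: derive_val. Qed.

Lemma derive1nD f g k : smooth f -> smooth g ->
  (D k (fun t => f t + g t)) = (fun t => (D k f) t + (D k g) t).
Proof.
move=> sf sg; elim: k => [//|k IH]; rewrite derive1nS IH.
apply: derive_eq_fun => t.
have df := smooth_derive k t sf; have dg := smooth_derive k t sg.
exact: (is_deriveD df dg).
Qed.

Lemma smoothD f g : smooth f -> smooth g -> smooth (fun t => f t + g t).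
Proof.
by move=> sf sg k t; rewrite derive1nD//; exact: (derivableD (sf k t) (sg k t)).
Qed.

Lemma derive1nZ f (c : R) k : smooth f ->
  (D k (fun t => c *: f t)) = (fun t => c *: (D k f) t).
Proof.
move=> sf; elim: k => [//|k IH]; rewrite derive1nS IH.
apply: derive_eq_fun => t.
exact: (is_deriveZ c (smooth_derive k t sf)).
Qed.

Lemma smoothZ f (c : R) : smooth f -> smooth (fun t => c *: f t).
Proof. by move=> sf k t; rewrite derive1nZ//; exact: (derivableZ (k := c) (sf k t)). Qed.

Lemma derive1nB f g k : smooth f -> smooth g ->
  (D k (fun t => f t - g t)) = (fun t => (D k f) t - (D k g) t).
Proof.
move=> sf sg; have -> : (fun t => f t - g t) = (fun t => f t + (-1) *: g t).
  by apply/funext => t; rewrite scaleN1r.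
rewrite (derive1nD k sf (smoothZ (c := -1) sg)) (derive1nZ (-1) k sg).
by apply/funext => t; rewrite scaleN1r.
Qed.

Lemma smoothB f g : smooth f -> smooth g -> smooth (fun t => f t - g t).
Proof.
move=> sf sg; have -> : (fun t => f t - g t) = (fun t => f t + (-1) *: g t).
  by apply/funext => t; rewrite scaleN1r.
exact: (smoothD sf (smoothZ (c := -1) sg)).
Qed.

Lemma smooth_cst v : smooth (fun=> v).
Proof.
have E k t : D k (fun _ : R => v) t = if k is 0%N then v else 0.
  elim: k t => [//|k IH] t; rewrite derive1nS (_ : (D k _) = cst (if k is 0%N then v else 0)).
    by rewrite derive1_cst.
  by apply/funext => x; rewrite IH.
move=> k t; rewrite (_ : (D k _) = cst (if k is 0%N then v else 0)) //.
by apply/funext => x; rewrite E.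
Qed.

Lemma smooth_sum (I : Type) (r : seq I) (F : I -> R -> R * R) :
  (forall i, smooth (F i)) ->
  smooth (fun t => \sum_(i <- r) F i t) /\
  forall k, (D k (fun t => \sum_(i <- r) F i t)) = (fun t => \sum_(i <- r) (D k (F i)) t).
Proof.
move=> sF; elim: r => [|i r [IH IHk]].
  have -> : (fun t => \sum_(i <- [::]) F i t) = (fun=> 0).
    by apply/funext => t; rewrite big_nil.
  split=> [|k]; first exact: smooth_cst.
  apply/funext => t; rewrite big_nil.
  elim: k t => [//|k IHk] t; rewrite derive1nS (_ : (D k _) = cst 0) ?derive1_cst//.
  by apply/funext => x; rewrite IHk.
have E : (fun t => \sum_(i <- i :: r) F i t) = (fun t => F i t + \sum_(i <- r) F i t).
  by apply/funext => t; rewrite big_cons.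
rewrite E; split=> [|k]; first exact: (smoothD (sF i) IH).
by rewrite (derive1nD k (sF i) IH) IHk; apply/funext => t; rewrite big_cons.
Qed.

Lemma le_mean_value (a a' : R -> R) (M : R) t s :
  (forall t, is_derive t 1 a (a' t)) -> (forall t, `|a' t| <= M) ->
  `|a t - a s| <= M * `|t - s|.
Proof.
move=> da Ma; wlog st : t s / s <= t.
  move=> wl; case: (leP s t) => [|/ltW] st; first exact: wl.
  by rewrite distrC [`|t - s|]distrC; exact: wl.
have ca : {within `[s, t], continuous a}.
  apply: continuous_subspaceT => x.
  by apply/differentiable_continuous/derivable1_diffP; case: (da x).
have [c _ ->] := MVT_segment st (fun x _ => da x) ca.
by rewrite normrM ler_wpM2r.
Qed.

Lemma curve_lipschitz f k (M : R) t s : smooth f ->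
  (forall t, `|(D k.+1 f) t| <= M) -> `|(D k f) t - (D k f) s| <= M * `|t - s|.
Proof.
move=> sf Mf; rewrite prod_normE ge_max /=; apply/andP; split.
- apply: (le_mean_value (a := fun t => (D k f t).1) (a' := fun t => (D k.+1 f t).1)) => x.
    exact: smooth_fst.
  by apply: le_trans (Mf x); rewrite prod_normE le_max lexx.
- apply: (le_mean_value (a := fun t => (D k f t).2) (a' := fun t => (D k.+1 f t).2)) => x.
    exact: smooth_snd.
  by apply: le_trans (Mf x); rewrite prod_normE le_max lexx orbT.
Qed.

Lemma is_derive_det2 f g (f' g' : R * R) (r : R) t :
  is_derive t 1 (fun t => (f t).1) f'.1 -> is_derive t 1 (fun t => (f t).2) f'.2 ->
  is_derive t 1 (fun t => (g t).1) g'.1 -> is_derive t 1 (fun t => (g t).2) g'.2 ->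
  det2 f' (g t) + det2 (f t) g' = r ->
  is_derive t 1 (fun t => det2 (f t) (g t)) r.
Proof.
move=> f1 f2 g1 g2 <-; rewrite /det2.
have H := is_deriveB (is_deriveM f1 g2) (is_deriveM f2 g1).
by refine (is_derive_eq H _); rewrite /GRing.scale /=; ring.
Qed.

End PlaneCurves.

Section PlaneVectors.
Context {R : realType}.
Implicit Types (u v : R * R).

Lemma pi2_gt0 : 0 < 2 * pi :> R.
Proof. by rewrite mulr_gt0// pi_gt0. Qed.

Lemma det2_colinear u v : u != 0 -> det2 u v = 0 -> exists c : R, v = c *: u.
Proof.
case: u v => [a b] [c d]; rewrite /det2 /= => u0 /eqP; rewrite subr_eq0 => /eqP E.
have [a0|a0] := eqVneq a 0.
  have b0 : b != 0 by apply: contra u0 => /eqP->; rewrite a0.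
  exists (d / b); congr (_, _) => /=; rewrite /GRing.scale /= ?divfK//.
  by move/eqP: E; rewrite a0 mul0r mulr0 eq_sym mulf_eq0 (negbTE b0) => /eqP.
exists (c / a); congr (_, _) => /=; rewrite /GRing.scale /= ?divfK//.
by apply: (mulfI a0); rewrite E; field.
Qed.

Lemma det2vv u : det2 u u = 0.
Proof. by rewrite /det2 mulrC subrr. Qed.

Lemma det2_addNr u v (w : R * R) : det2 u v + det2 w (- w.1, - w.2) = det2 u v.
Proof. by rewrite /det2 /=; ring. Qed.

Lemma scale_inj u v (c d : R) : u != 0 -> v = c *: u -> v = d *: u -> c = d.
Proof.
move=> u0 -> /eqP; rewrite -subr_eq0 -scalerBl scaler_eq0 (negbTE u0) orbF.
by rewrite subr_eq0 => /eqP.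
Qed.

Lemma scale_trans u v (w : R * R) (c d : R) : w = d *: v -> v = c *: u -> w = (d * c) *: u.
Proof. by move=> -> ->; rewrite scalerA. Qed.

Lemma det2C u v : det2 u v = - det2 v u.
Proof. by rewrite /det2; ring. Qed.

Lemma det2_0add u v (w : R * R) : det2 (0, 0) u + det2 v w = det2 v w.
Proof. by rewrite /det2 /= !mul0r subrr add0r. Qed.

Lemma det2v0 u : det2 u 0 = 0.
Proof. by rewrite /det2 /= !mulr0 subrr. Qed.

Lemma det2_swap u v (w : R * R) : det2 u (v - w) = - det2 u (w - v).
Proof. by rewrite /det2 /=; ring. Qed.

Lemma det2_sub0 u (a b c : R * R) :
  det2 u (a - c) = 0 -> det2 u (b - c) = 0 -> det2 u (a - b) = 0.
Proof.
move=> ac bc; have -> : a - b = (a - c) + (c - b) by rewrite addrA subrK.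
by rewrite det2Dr ac add0r det2_swap bc oppr0.
Qed.

End PlaneVectors.

(** * Closed curves and the C^k norms *)
Section ClosedCurves.
Context {R : realType}.
Implicit Types (f g h : R -> R * R) (t s : R) (u v : R * R).
Local Notation D := (@derive1n R (R * R)%type).

Lemma periodicZ (T : Type) (a : R -> T) (n : int) t :
  (forall t, a (t + 2 * pi) = a t) -> a (t + n%:~R * (2 * pi)) = a t.
Proof.
move=> per.
have perN (m : nat) x : a (x + m%:R * (2 * pi)) = a x.
  elim: m x => [|m IH] x; first by rewrite mul0r addr0.
  by rewrite -natr1 mulrDl mul1r addrA per IH.
case: n => m; first by rewrite -pmulrn perN.
rewrite NegzE mulrNz mulNr -(perN m.+1) -pmulrn subrK//.
Qed.

Lemma circle_lift t : exists n : int, circle (t + n%:~R * (2 * pi)).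
Proof.
have pi2 : 0 < 2 * pi :> R by rewrite mulr_gt0// pi_gt0.
have /andP[l u] := mem_rg1_floor (t / (2 * pi)).
exists (- Num.floor (t / (2 * pi))).
rewrite /circle /= in_itv /= mulrNz mulNr subr_ge0 -ler_pdivlMr// l /=.
by move: u; rewrite /= ltr_pdivrMr// mulrDl mul1r -ltrBlDl.
Qed.

Definition closed_curve f := smooth f /\ forall t, f (t + 2 * pi) = f t.

Lemma derive_periodic f k t : (forall t, f (t + 2 * pi) = f t) ->
  D k f (t + 2 * pi) = D k f t.
Proof.
move=> per; elim: k t => [//|k IH] t; rewrite derive1nS /derive1 IH.
suff -> : (fun h : R => h^-1 *: (D k f (h + (t + 2 * pi)) - D k f t)) =
          (fun h : R => h^-1 *: (D k f (h + t) - D k f t)) by [].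
by apply/funext => h; rewrite addrA IH.
Qed.

Lemma closed_bounded f k : closed_curve f -> exists2 M : R, 0 < M & forall t, `|D k f t| <= M.
Proof.
move=> [sf per].
have pi2 : 0 <= 2 * pi :> R by rewrite mulr_ge0// pi_ge0.
have cf : {within `[0, 2 * pi], continuous (fun t => `|D k f t|)}.
  apply: continuous_subspaceT => x.
  apply: (continuous_comp (smooth_cont (k := k) sf (x := x))).
  exact: norm_continuous.
have [c _ cmax] := EVT_max pi2 cf.
exists (`|D k f c| + 1) => [|t]; first by rewrite ltr_wpDl.
have [n] := circle_lift t; rewrite /circle /= in_itv /= => /andP[l u].
rewrite -(@periodicZ _ (D k f) n t) => [|x]; last exact: derive_periodic.
apply: (@le_trans _ _ `|D k f c|); last by rewrite lerDl.
by apply: cmax; rewrite in_itv /= l ltW.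
Qed.

Lemma Cknorm_ge f j k t : closed_curve f -> (j <= k)%N -> `|D j f t| <= Cknorm k f.
Proof.
move=> cf jk; have [M _ HM] := closed_bounded j cf.
have jk' : (j < k.+1)%N by [].
apply: le_trans (le_bigmax _ (fun i : 'I_k.+1 => sup (range (fun t => `|D i f t|)))
  (Ordinal jk')) => /=.
apply: sup_ubound; last by exists t.
by exists M => _ [x _ <-]; exact: HM.
Qed.

Lemma Cknorm_ub f k (M : R) : 0 <= M ->
  (forall j t, (j <= k)%N -> `|D j f t| <= M) -> Cknorm k f <= M.
Proof.
move=> M0 fM; apply/bigmax_leP; split=> // i _.
apply: sup_le_ub; first by exists `|D i f 0|; exists 0.
by move=> _ [x _ <-]; apply: fM; rewrite -ltnS.
Qed.

Lemma Cknorm_ge0 f k : 0 <= Cknorm k f.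
Proof. exact: bigmax_ge_id. Qed.

Lemma closedD f g : closed_curve f -> closed_curve g -> closed_curve (fun t => f t + g t).
Proof.
move=> [sf pf] [sg pg]; split; first exact: (smoothD sf sg).
by move=> t; rewrite pf pg.
Qed.

Lemma closedB f g : closed_curve f -> closed_curve g -> closed_curve (fun t => f t - g t).
Proof.
move=> [sf pf] [sg pg]; split; first exact: (smoothB sf sg).
by move=> t; rewrite pf pg.
Qed.

Lemma closedZ f (c : R) : closed_curve f -> closed_curve (fun t => c *: f t).
Proof.
move=> [sf pf]; split; first exact: (smoothZ (c := c) sf).
by move=> t; rewrite pf.
Qed.

Lemma CknormD f g k : closed_curve f -> closed_curve g ->
  Cknorm k (fun t => f t + g t) <= Cknorm k f + Cknorm k g.
Proof.
move=> cf cg; apply: Cknorm_ub => [|j t jk]; first by rewrite addr_ge0// Cknorm_ge0.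
rewrite (derive1nD j cf.1 cg.1); apply: (le_trans (ler_normD _ _)).
exact: lerD (Cknorm_ge t cf jk) (Cknorm_ge t cg jk).
Qed.

Lemma CknormZ f (c : R) k : closed_curve f ->
  Cknorm k (fun t => c *: f t) <= `|c| * Cknorm k f.
Proof.
move=> cf; apply: Cknorm_ub => [|j t jk]; first by rewrite mulr_ge0// Cknorm_ge0.
by rewrite (derive1nZ c j cf.1) normrZ ler_wpM2l// (Cknorm_ge t cf jk).
Qed.

Lemma closed_sum (I : Type) (r : seq I) (c : I -> R) (F : I -> R -> R * R) k :
  (forall i, closed_curve (F i)) ->
  closed_curve (fun t => \sum_(i <- r) c i *: F i t) /\
  Cknorm k (fun t => \sum_(i <- r) c i *: F i t)
    <= \sum_(i <- r) `|c i| * Cknorm k (F i).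
Proof.
move=> cF; elim: r => [|i r [IH IHk]].
  have -> : (fun t => \sum_(i <- [::]) c i *: F i t) = (fun=> 0 *: (0, 0)).
    by apply/funext => t; rewrite big_nil scale0r.
  have c0 : closed_curve (fun=> (0, 0)) by split=> //; exact: smooth_cst.
  split; first exact: (closedZ 0 c0).
  rewrite big_nil; apply: (le_trans (CknormZ 0 k c0)); by rewrite normr0 mul0r.
have E : (fun t => \sum_(i <- i :: r) c i *: F i t) =
    (fun t => c i *: F i t + \sum_(i <- r) c i *: F i t).
  by apply/funext => t; rewrite big_cons.
rewrite E big_cons; split; first exact: (closedD (closedZ (c i) (cF i)) IH).
apply: (le_trans (CknormD k (closedZ (c i) (cF i)) IH)).
by apply: lerD => //; exact: (CknormZ (c i) k (cF i)).
Qed.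

Lemma table_closed (g : table R) : closed_curve g.
Proof. by case: (tableP g) => sg pg _ _ _ _; split. Qed.

Lemma Ckball_self (g : table R) k (e : R) : 0 < e -> Ckball g k e g.
Proof.
move=> e0; rewrite /Ckball /=; apply: le_lt_trans e0; apply: Cknorm_ub => // j t _.
by have c := (table_closed g).1; rewrite (derive1nB j c c) subrr normr0.
Qed.

Lemma Ckball_open (g : table R) k (e : R) : open (Ckball g k e).
Proof.
suff : Cinfty_open (Ckball g k e) by [].
move=> h gh; exists k, (e - Cknorm k (fun t => h t - g t)).
split=> [|f]; first by rewrite subr_gt0.
rewrite /Ckball /= ltrBrDr; apply: le_lt_trans.
have -> : (fun t => f t - g t) = (fun t => (f t - h t) + (h t - g t)).
  by apply/funext => t; rewrite addrA subrK.
by apply: CknormD; apply: closedB; exact: table_closed.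
Qed.

Lemma Ckball_nbhs (g : table R) k (e : R) : 0 < e -> nbhs g (Ckball g k e).
Proof. by move=> e0; apply: open_nbhs_nbhs; split; [exact: Ckball_open|exact: Ckball_self]. Qed.

Lemma nbhs_Ckball (g : table R) (A : set (table R)) : nbhs g A ->
  exists k e, 0 < e /\ Ckball g k e `<=` A.
Proof.
rewrite nbhsE => -[U [oU Ug] UA].
have /(_ g Ug)[k [e [e0 kU]]] : Cinfty_open U by exact: oU.
by exists k, e; split => //; exact: subset_trans UA.
Qed.

Lemma Ckball_near (g h : table R) k (e : R) j t : Ckball g k e h -> (j <= k)%N ->
  `|D j h t - D j g t| < e.
Proof.
move=> gh jk; apply: le_lt_trans gh.
have ch := table_closed h; have cg := table_closed g.
have := Cknorm_ge t (closedB ch cg) jk.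
by rewrite (derive1nB j ch.1 cg.1).
Qed.

End ClosedCurves.

(** * Strict convexity and the phase space *)
Section ConvexGeometry.
Local Opaque derive1 det2.
Context {R : realType}.
Variable g : table R.
Implicit Types (t s x y : R) (u v : R * R).
Local Notation D := (@derive1n R (R * R)%type).

Let sg : smooth g := (table_closed g).1.
Let pg t : g (t + 2 * pi) = g t := (table_closed g).2 t.

Lemma is_derive_det2r (f : R -> R * R) k t u v : smooth f ->
  is_derive t 1 (fun t => det2 u (D k f t - v)) (det2 u (D k.+1 f t)).
Proof.
move=> sf.
apply: (@is_derive_det2 R (fun=> u) (fun t => D k f t - v) (0, 0) (D k.+1 f t)) => /=.
- exact: (is_derive_cst u.1 t 1).
- exact: (is_derive_cst u.2 t 1).
- by have := is_deriveB (smooth_fst k t sf) (is_derive_cst v.1 t 1); rewrite subr0.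
- by have := is_deriveB (smooth_snd k t sf) (is_derive_cst v.2 t 1); rewrite subr0.
- exact: det2_0add.
Qed.

Lemma is_derive_det2_moving (f : R -> R * R) t v : smooth f ->
  is_derive t 1 (fun t => det2 (D 1 f t) (v - f t)) (det2 (D 2 f t) (v - f t)).
Proof.
move=> sf.
apply: (@is_derive_det2 R (D 1 f) (fun t => v - f t) (D 2 f t)
  (- (D 1 f t).1, - (D 1 f t).2)) => /=.
- exact: (smooth_fst 1 t sf).
- exact: (smooth_snd 1 t sf).
- by have := is_deriveB (is_derive_cst v.1 t 1) (smooth_fst 0 t sf); rewrite sub0r.
- by have := is_deriveB (is_derive_cst v.2 t 1) (smooth_snd 0 t sf); rewrite sub0r.
- exact: det2_addNr.
Qed.

Lemma derive_at_min (a : R -> R) (a' : R -> R) s :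
  (forall x, is_derive x 1 a (a' x)) -> (forall x, a s <= a x) -> a' s = 0.
Proof.
move=> da mina.
have /@derive_val : is_derive s 1 a 0.
  apply: (@derive1_at_min _ a (s - 1) (s + 1) s) => //.
  - by rewrite lerBlDr -addrA lerDl addr_ge0.
  - by rewrite in_itv /= ltrBlDr ltrDl ltr01.
by have /@derive_val -> := da s.
Qed.

Lemma turning_gt0 t : 0 < det2 (g^`() t) (g^`(2) t).
Proof.
have := table_curvature (tableP g) t; rewrite /curvature.
apply: contraTT; rewrite -!leNgt => d0.
by apply: mulr_le0_ge0 => //; rewrite invr_ge0 exprn_ge0// sqrtr_ge0.
Qed.

Lemma left_of_tangent t s : 0 <= det2 (g^`() t) (g s - g t).
Proof. by have := @table_region _ _ (tableP g) (g s); apply; exists s. Qed.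

(** Suppose that g s lies on the tangent at t. Then the two functions
    x |-> det (g' t, g x - g t) and x |-> det (g' x, g t - g x), which are
    nonnegative, vanish at x = s, and so do their derivatives. The first
    derivative says that the tangents at s and t are parallel; the turning at s
    being positive, the second one then forces g s = g t. *)
Lemma strictly_left t s : g s <> g t -> 0 < det2 (g^`() t) (g s - g t).
Proof.
move=> st; rewrite lt_def left_of_tangent andbT; apply/eqP => E.
have g't0 := table_regular (tableP g) t; have g's0 := table_regular (tableP g) s.
have st0 : det2 (g^`() s) (g^`() t) = 0.
  rewrite det2C; apply/eqP; rewrite oppr_eq0; apply/eqP.
  apply: (@derive_at_min (fun x => det2 (g^`() t) (D 0 g x - g t))
    (fun x => det2 (g^`() t) (D 1 g x)) s) => x; first exact: is_derive_det2r.
  by rewrite /= E left_of_tangent.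
have [l El] := det2_colinear g's0 st0.
have [c Ec] := det2_colinear g't0 E.
have Ets : g t - g s = - (c * l) *: D 1 g s.
  by rewrite -opprB Ec El scalerA scaleNr.
(* The tangent at s contains g t as well: both functions have a minimum at s. *)
have dpsi := fun x => is_derive_det2_moving x (g t) sg.
have : det2 (D 2 g s) (g t - g s) = 0.
  apply: (derive_at_min dpsi) => x.
  by rewrite [X in X <= _](_ : _ = 0) ?left_of_tangent// Ets det2Zr det2vv mulr0.
rewrite Ets det2Zr det2C mulrN => /eqP; rewrite oppr_eq0 mulf_eq0.
rewrite [_ == 0 in X in _ || X]gt_eqF ?turning_gt0// orbF oppr_eq0 => /eqP cl0.
by apply: st; apply/esym/eqP; rewrite -subr_eq0 Ets cl0 oppr0 scale0r.
Qed.

Lemma curve_inj x y : g x = g y -> `|x - y| < 2 * pi -> x = y.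
Proof.
move=> gxy; have [n cn] := circle_lift x; have [m cm] := circle_lift y.
have : x + n%:~R * (2 * pi) = y + m%:~R * (2 * pi).
  by apply: (table_injective (tableP g)); rewrite ?inE// !(periodicZ _ _ pg).
move=> E; have {}E : x - y = (m - n)%:~R * (2 * pi) by rewrite intrB; lra.
rewrite E normrM (gtr0_norm pi2_gt0) gtr_pMl ?pi2_gt0//.
rewrite -intr_norm -[1]/(1%:~R) ltr_int => mn.
have {mn}mn : m - n = 0 by move: mn; case: (m - n) => [[|k]|k].
by apply/eqP; rewrite -subr_eq0 E mn mul0r.
Qed.

(** Two points cannot lie strictly on the left of each other's tangents when
    these have the same direction. *)
Lemma opposite_tangent t x : det2 (g^`() t) (g^`() x) = 0 -> g x <> g t ->
  exists2 c : R, c < 0 & g^`() x = c *: D 1 g t.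
Proof.
move=> tx nxt; have [c Ec] := det2_colinear (table_regular (tableP g) t) tx.
exists c => //; have g'x0 := table_regular (tableP g) x.
rewrite ltNge; apply/negP => c0.
have := strictly_left (fun e : g t = g x => nxt (esym e)).
rewrite det2_swap Ec det2Zl oppr_gt0 ltNge => /negP; apply.
by rewrite mulr_ge0// left_of_tangent.
Qed.

(** Among three parallel tangents, two have the same direction. *)
Lemma star_unique t s x : circle t -> is_star g t s ->
  det2 (g^`() t) (g^`() x) = 0 -> g x = g t \/ g x = g s.
Proof.
move=> ct [cs st ts] tx.
have nst : g s <> g t.
  by move=> /(table_injective (tableP g)); rewrite !inE => /(_ cs ct) /eqP; rewrite (negbTE st).
have [|nxt] := pselect (g x = g t); first by left.
right; apply: contrapT => nxs.
have [c c0 Ec] := opposite_tangent ts nst; have [d d0 Ed] := opposite_tangent tx nxt.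
have sx : det2 (g^`() s) (g^`() x) = 0 by rewrite Ec Ed det2Zl det2Zr det2vv !mulr0.
have [e e0 Ee] := opposite_tangent sx nxs.
have Ee' := scale_trans Ee Ec.
have dec := scale_inj (table_regular (tableP g) t) Ed Ee'.
have ec : 0 < e * c by rewrite nmulr_rgt0.
by move: d0; rewrite dec ltNge ltW.
Qed.

(** On the real line, cyclic order becomes linear order once a and s are
    replaced by their representatives that follow t. *)
Lemma arc_lift t a s : circle t -> circle a -> circle s -> cyclic_lt t a s ->
  exists a1 s1, [/\ t < a1, a1 < s1 & s1 < t + 2 * pi] /\
    ((a1 = a \/ a1 = a + 2 * pi) /\ (s1 = s \/ s1 = s + 2 * pi)).
Proof.
rewrite /circle /= !in_itv /= /cyclic_lt => /andP[t0 t1] /andP[a0 a1] /andP[s0 s1].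
have p0 := pi2_gt0.
case/or3P => /andP[h1 h2].
- by exists a, s; split; [split=> //; lra|split; left].
- by exists (a + 2 * pi), (s + 2 * pi); split; [split; lra|split; right].
- by exists a, (s + 2 * pi); split; [split; lra|split; [left|right]].
Qed.

(** As g x lies to the left of the tangent at t, the mean value theorem gives
    a point before x where the determinant is positive. A change of sign would
    produce a parallel tangent different from those at t and at t^*. *)
Lemma arc_det_gt0 t s s1 x : circle t -> is_star g t s -> g s1 = g s ->
  t < x -> x < s1 -> s1 < t + 2 * pi -> 0 < det2 (g^`() t) (g^`() x).
Proof.
move=> ct st ss tx xs1 s1t; have p0 := pi2_gt0.
pose phi k y := det2 (g^`() t) (D k g y - if k is 0%N then g t else 0).
have dphi k y : is_derive y 1 (phi k) (phi k.+1 y).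
  by rewrite /phi subr0; exact: is_derive_det2r.
have cphi k : continuous (phi k).
  by move=> y; apply/differentiable_continuous/derivable1_diffP; case: (dphi k y).
have [c + Ec] := MVT tx (fun y _ => dphi 0%N y) (continuous_subspaceT (cphi 0%N)).
rewrite in_itv /= => /andP[tc cx].
have c0 : 0 < phi 1%N c.
  have : 0 < phi 0%N x - phi 0%N t.
    rewrite /phi /= subrr det2v0 subr0; apply: strictly_left.
    have xt2 : `|x - t| < 2 * pi by clear -tx xs1 s1t p0; rewrite ltr_norml; lra.
    by move=> /curve_inj /(_ xt2) E; rewrite E ltxx in tx.
  by rewrite Ec pmulr_lgt0// subr_gt0.
have -> : det2 (g^`() t) (g^`() x) = phi 1%N x by rewrite /phi subr0.
rewrite ltNge; apply/negP => x0.
have [|z + /eqP] := @IVT R (phi 1%N) c x 0 (ltW cx) (continuous_subspaceT (cphi 1%N)).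
  apply/andP; split; first by rewrite ge_min; apply/orP; right; exact: x0.
  by rewrite le_max; apply/orP; left; exact: (ltW c0).
rewrite in_itv /= => /andP[cz zx] /eqP.
move=> phiz.
have [zt zs] : t < z /\ z < s1.
  by clear -tc cz zx xs1; split; [exact: lt_le_trans tc cz|exact: le_lt_trans zx xs1].
have [zt2 zs2] : `|z - t| < 2 * pi /\ `|z - s1| < 2 * pi.
  by clear -tx zt zs xs1 s1t p0; rewrite !ltr_norml; split; lra.
have [] := star_unique ct st (esym (etrans (esym phiz) (congr1 _ (subr0 _)))).
- by move=> /curve_inj /(_ zt2) E; rewrite E ltxx in zt.
- by rewrite -ss => /curve_inj /(_ zs2) E; rewrite E ltxx in zs.
Qed.

Lemma chord_phase_det t a : chord_phase g t a -> 0 < det2 (g^`() t) (g^`() a).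
Proof.
move=> [ct ca [s sts cyc]]; have cs : circle s by case: sts.
have [a1 [s1 [[ta as1 s1t] [Ea Es]]]] := arc_lift ct ca cs cyc.
have -> : g^`() a = g^`() a1.
  case: Ea => ->; first exact: erefl.
  exact: (esym (derive_periodic 1 a pg)).
by apply: (@arc_det_gt0 t s s1) => //; case: Es => ->; rewrite ?pg.
Qed.

(** The determinant of the tangents at both ends of a chord of the phase space
    is positive, and it changes sign with the orientation of the chord. *)
Lemma chord_phase_asym t a : chord_phase g t a -> ~ chord_phase g a t.
Proof.
move=> /chord_phase_det ta /chord_phase_det; rewrite det2C; lra.
Qed.

(** Along the arc from t to t^*, the height over the tangent at t increases, so
    that it determines the end of the chord. This gives both the injectivity of
    the coordinates (t, s) and the determinism of the billiard map. *)
Lemma chord_phase_inj t a b : chord_phase g t a -> chord_phase g t b ->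
  det2 (g^`() t) (g a - g b) = 0 -> a = b.
Proof.
move=> [ct ca [s sts cyca]] [_ cb [s' sts' cycb]] E.
have cs : circle s by case: sts.
have ss' : s' = s.
  have [cs' s't ts'] := sts'; case: (star_unique ct sts ts').
    by move=> /(table_injective (tableP g)); rewrite !inE => /(_ cs' ct) /eqP; rewrite (negbTE s't).
  by move=> /(table_injective (tableP g)); rewrite !inE => /(_ cs' cs).
rewrite {}ss' in cycb sts'.
have [a1 [s1 [[ta as1 s1t] [Ea Es]]]] := arc_lift ct ca cs cyca.
have [b1 [s2 [[tb bs2 s2t] [Eb Es2]]]] := arc_lift ct cb cs cycb.
have gs1 : g s1 = g s by case: Es => ->; rewrite ?pg.
have gs2 : g s2 = g s by case: Es2 => ->; rewrite ?pg.
have ga : g a1 = g a by case: Ea => ->; rewrite ?pg.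
have gb : g b1 = g b by case: Eb => ->; rewrite ?pg.
have s12 : s2 = s1.
  apply: curve_inj; first by rewrite gs1.
  by clear -ta as1 s1t tb bs2 s2t; rewrite ltr_norml; lra.
rewrite -{}ga -{}gb in E; rewrite {}s12 in bs2 {gs2 s2t Es2}.
suff ab : a1 = b1.
  apply: (table_injective (tableP g)); rewrite ?inE//.
  by case: Ea Eb ab => -> [] -> ab; rewrite -?[g a]pg -?[g b]pg ab ?pg.
clear -sg pg ct sts gs1 ta as1 s1t tb bs2 E.
wlog ab : a1 b1 ta tb as1 bs2 E / a1 < b1 => [wl|].
  have [ab|ab|//] := ltgtP a1 b1; first exact: wl.
  by apply/esym; apply: wl => //; rewrite det2_swap E oppr0.
have dphi y : is_derive y 1 (fun y => det2 (g^`() t) (D 0 g y - g a1)) (det2 (g^`() t) (D 1 g y)).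
  exact: is_derive_det2r.
have cphi : continuous (fun y => det2 (g^`() t) (D 0 g y - g a1)).
  by move=> y; apply/differentiable_continuous/derivable1_diffP; case: (dphi y).
have [c] := MVT ab (fun y _ => dphi y) (continuous_subspaceT cphi).
rewrite in_itv /= => /andP[ac cb].
have -> : det2 (g^`() t) (D 0 g b1 - g a1) = 0 by rewrite det2_swap E oppr0.
have -> : det2 (g^`() t) (D 0 g a1 - g a1) = 0 by rewrite subrr det2v0.
have := @arc_det_gt0 t s s1 c ct sts gs1 (lt_trans ta ac) (lt_trans cb bs2) s1t.
rewrite subrr => c0 cE; have := mulr_gt0 c0 (_ : 0 < b1 - a1).
by rewrite -cE ltxx subr_gt0 => /(_ ab).
Qed.

End ConvexGeometry.

(** * Coinciding reflection points give an overdetermined system *)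
Section Orbits.
Context {R : realType}.
Variables (g : table R) (O : R * R).
Implicit Types (t s : R) (x y z : R * R) (p q : nat -> R * R).
Local Opaque derive1 det2.

Definition reflects (t a b : R) := det2 (g^`() t) (g b - g a) = 0.

Lemma coords_inj t a b : chord_phase g t a -> chord_phase g t b ->
  coords g O t a = coords g O t b -> a = b.
Proof.
move=> pa pb [] /oppr_inj; rewrite !genL1E => /eqP.
rewrite -subr_eq0 -det2Nr -det2Dr opprB addrA subrK => /eqP E.
exact: (chord_phase_inj pa pb E).
Qed.

Lemma billiard_chord x y z : billiard_map g O x y -> billiard_map g O y z ->
  chord_map g x.1 y.1 z.1.
Proof.
move=> [t1 [t2 [t3 [m -> Ey]]]] [s1 [s2 [s3 [m' Ey' ->]]]].
have [_ p2 _] := m; have [p1' _ _] := m'.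
have s1t2 : s1 = t2 by have := congr1 fst Ey'; rewrite Ey.
rewrite {}s1t2 in Ey' p1' *.
have s2t3 : t3 = s2 by apply: (coords_inj p2 p1'); rewrite -Ey -Ey'.
by rewrite -{}s2t3 Ey.
Qed.

Lemma billiard_coords x y : billiard_map g O x y ->
  chord_phase g x.1 y.1 /\ x = coords g O x.1 y.1.
Proof. by move=> [t1 [t2 [t3 [[p _ _] -> ->]]]]. Qed.

(** Indexing an orbit by all natural numbers avoids reductions modulo its
    period. *)
Definition unrolled (P : nat -> R * R) := forall i, billiard_map g O (P i) (P i.+1).

Lemma unrolled_step P Q i j : unrolled P -> unrolled Q ->
  P i = Q j -> P i.+1 = Q j.+1.
Proof.
move=> uP uQ E.
have [cP EP] := billiard_coords (uP i); have [cQ EQ] := billiard_coords (uQ j).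
have [cP' EP'] := billiard_coords (uP i.+1); have [cQ' EQ'] := billiard_coords (uQ j.+1).
have E1 : (P i.+1).1 = (Q j.+1).1.
  by rewrite E in cP EP; apply: (coords_inj cP cQ); rewrite -EP -EQ.
have [_ _ dP] := billiard_chord (uP i) (uP i.+1).
have [_ _ dQ] := billiard_chord (uQ j) (uQ j.+1).
rewrite EP' EQ' E1; congr coords.
rewrite E1 in cP'; apply: (chord_phase_inj cP' cQ').
by rewrite E E1 in dP; exact: det2_sub0 dP dQ.
Qed.

Lemma unrolled_eq P Q i j l : unrolled P -> unrolled Q ->
  P i = Q j -> P (i + l)%N = Q (j + l)%N.
Proof.
by move=> uP uQ E; elim: l => [|l IH]; rewrite ?addn0// !addnS; exact: unrolled_step.
Qed.

(** At a common reflection point of two distinct states, the previous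
    reflection points differ, because a chord determines its successors. A
    previous reflection point is not a next one either, by
    [chord_phase_asym]. *)
Lemma crossing_neighbours P Q i j : unrolled P -> unrolled Q ->
  (P i.+1).1 = (Q j.+1).1 -> P i.+1 <> Q j.+1 ->
  (Q j).1 \notin [:: (P i).1; (P i.+2).1; (Q j.+2).1].
Proof.
move=> uP uQ E nPQ.
have [cP EP] := billiard_coords (uP i); have [cQ EQ] := billiard_coords (uQ j).
have [cP' _] := billiard_coords (uP i.+1); have [cQ' _] := billiard_coords (uQ j.+1).
rewrite !inE !negb_or; apply/and3P; split; apply/eqP => N.
- by apply: nPQ; apply: unrolled_step => //; rewrite EP EQ N E.
- by rewrite E -N in cP'; exact: (chord_phase_asym cQ cP').
- by rewrite -N in cQ'; exact: (chord_phase_asym cQ cQ').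
Qed.

Lemma unrolled_neq P i : unrolled P -> (P i).1 <> (P i.+2).1.
Proof.
move=> uP N.
have [cP _] := billiard_coords (uP i); have [cP' _] := billiard_coords (uP i.+1).
by rewrite -N in cP'; exact: (chord_phase_asym cP cP').
Qed.

Definition unroll n p i := p (i %% n)%N.

Lemma unrollP n p : periodic_orbit g O n p -> unrolled (unroll n p).
Proof.
move=> [n0 _ op pn _] i; have in_ : (i %% n < n)%N by rewrite ltn_mod.
have -> : unroll n p i.+1 = p (i %% n).+1; last exact: op.
rewrite /unroll -addn1 -modnDml addn1.
have [E|] := eqVneq (i %% n).+1 n; first by rewrite E modnn pn.
by move=> ne; rewrite modn_small// ltn_neqAle ne.
Qed.

Lemma orbit_states_distinct n p i j : periodic_orbit g O n p ->
  (i < j)%N -> (j < n)%N -> p i <> p j.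
Proof.
move=> op ij jn E; have in_ : (i < n)%N by exact: ltn_trans jn.
have uE : unroll n p i = unroll n p j by rewrite /unroll !modn_small.
have := unrolled_eq (n - i) (unrollP op) (unrollP op) uE.
rewrite /unroll subnKC 1?ltnW// modnn => /esym.
have -> : (j + (n - i) = j - i + n)%N.
  by rewrite addnBA 1?ltnW// [RHS]addnC addnBA 1?ltnW// addnC.
rewrite modnDr modn_small ?(leq_ltn_trans (leq_subr _ _))//.
by apply: (orbit_least op); rewrite subn_gt0 ij (leq_ltn_trans (leq_subr _ _)).
Qed.

End Orbits.

Section OrbitSets.
Context {R : realType}.
Variables (g : table R) (O : R * R).

Lemma orbit_set_sub n m (p q : nat -> R * R) i j :
  periodic_orbit g O n p -> periodic_orbit g O m q ->
  (i < n)%N -> (j < m)%N -> p i = q j -> orbit_set n p `<=` orbit_set m q.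
Proof.
move=> op oq in_ jm E _ [k kn <-].
have uE : unroll n p i = unroll m q j by rewrite /unroll !modn_small.
have := unrolled_eq (k + n * i - i) (unrollP op) (unrollP oq) uE.
rewrite subnKC; last first.
  by apply: leq_trans (leq_addl _ _); rewrite leq_pmull// (orbit_gt0 op).
rewrite {1}/unroll [(n * i)%N]mulnC [X in (X %% n)%N]addnC modnMDl modn_small// => ->.
by exists ((j + (k + i * n - i)) %% m)%N => //=; rewrite ltn_mod (orbit_gt0 oq).
Qed.

(** One equation for each parameter in A, and one more at a0. The conditions on
    p1 ensure that moving g p1 alone changes the second chord reflected at a0,
    and leaves the first one in place. *)
Definition overdetermined (A : seq R) := exists a0 p0 q0 p1 q1 : R,
  [/\ uniq A /\ (forall a, a \in A -> circle a),
      all (mem A) [:: a0; p0; q0; p1; q1],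
      p0 <> q0 /\ p1 \notin [:: p0; q0; q1],
      reflects g a0 p0 q0 /\ reflects g a0 p1 q1 &
      forall a, a \in A -> exists p q, [/\ p \in A, q \in A, p <> q & reflects g a p q]].

(** A consists of the reflection parameters of both orbits; the common point
    plays the role of a0. *)
Lemma crossing_overdetermined n m (p q : nat -> R * R) i j :
  periodic_orbit g O n p -> periodic_orbit g O m q ->
  (i < n)%N -> (j < m)%N -> (p i).1 = (q j).1 -> p i <> q j ->
  exists A, overdetermined A.
Proof.
move=> op oq in_ jm Et Es.
set P := unroll n p; set Q := unroll m q.
have uP : unrolled g O P := unrollP op; have uQ : unrolled g O Q := unrollP oq.
pose A := undup ([seq (p k).1 | k <- iota 0 n] ++ [seq (q k).1 | k <- iota 0 m]).
have PA k : (P k).1 \in A.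
  rewrite mem_undup mem_cat; apply/orP; left.
  by apply: (map_f (fun k => (p k).1)); rewrite mem_iota add0n ltn_mod (orbit_gt0 op).
have QA k : (Q k).1 \in A.
  rewrite mem_undup mem_cat; apply/orP; right.
  by apply: (map_f (fun k => (q k).1)); rewrite mem_iota add0n ltn_mod (orbit_gt0 oq).
have AP a : a \in A -> (exists k, a = (P k.+1).1) \/ (exists k, a = (Q k.+1).1).
  rewrite mem_undup mem_cat => /orP[] /mapP[k]; rewrite mem_iota add0n => /andP[_ kn] ->.
  - left; exists (k + n.-1)%N; rewrite -addnS prednK ?(orbit_gt0 op)//.
    by rewrite /P /unroll modnDr modn_small.
  - right; exists (k + m.-1)%N; rewrite -addnS prednK ?(orbit_gt0 oq)//.
    by rewrite /Q /unroll modnDr modn_small.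
(* one period later, every state has a predecessor *)
have i1 : P (i + n.-1).+1 = p i.
  by rewrite -addnS prednK ?(orbit_gt0 op)// /P /unroll modnDr modn_small.
have j1 : Q (j + m.-1).+1 = q j.
  by rewrite -addnS prednK ?(orbit_gt0 oq)// /Q /unroll modnDr modn_small.
move: (i + n.-1)%N (j + m.-1)%N i1 j1 => {in_}i' {jm}j' i1 j1.
rewrite -{}i1 -{}j1 in Et Es.
have rP k : reflects g (P k.+1).1 (P k).1 (P k.+2).1.
  by have [] := billiard_chord (uP k) (uP k.+1).
have rQ k : reflects g (Q k.+1).1 (Q k).1 (Q k.+2).1.
  by have [] := billiard_chord (uQ k) (uQ k.+1).
exists A; exists (P i'.+1).1, (P i').1, (P i'.+2).1, (Q j').1, (Q j'.+2).1; split.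
- split; first exact: undup_uniq.
  move=> a /AP[] [k ->].
    by have [] := billiard_chord (uP k) (uP k.+1) => -[_ c _].
  by have [] := billiard_chord (uQ k) (uQ k.+1) => -[_ c _].
- by rewrite /= !PA !QA.
- by split; [exact: unrolled_neq uP|exact: crossing_neighbours uP uQ Et Es].
- by split; [exact: rP|rewrite Et; exact: rQ].
- move=> a /AP[] [k ->].
    by exists (P k).1, (P k.+2).1; split=> //; exact: unrolled_neq uP.
  by exists (Q k).1, (Q k.+2).1; split=> //; exact: unrolled_neq uQ.
Qed.

End OrbitSets.

(** * Stability of tables under C^2-small perturbations *)
Section Stability.
Context {R : realType}.
Implicit Types (f g h V : R -> R * R) (t s y : R).
Local Notation D := (@derive1n R (R * R)%type).

Lemma cvg_det2 (T : Type) (F : set_system T) (FF : Filter F) (a b : T -> R * R) (u v : R * R) :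
  a @ F --> u -> b @ F --> v -> (fun x => det2 (a x) (b x)) @ F --> det2 u v.
Proof.
move=> au bv; rewrite /det2.
have a1 : (fun x => (a x).1) @ F --> u.1.
  by move: au; case: (u) => u1 u2 au; apply: cvg_comp au _; exact: cvg_fst.
have a2 : (fun x => (a x).2) @ F --> u.2.
  by move: au; case: (u) => u1 u2 au; apply: cvg_comp au _; exact: cvg_snd.
have b1 : (fun x => (b x).1) @ F --> v.1.
  by move: bv; case: (v) => v1 v2 bv; apply: cvg_comp bv _; exact: cvg_fst.
have b2 : (fun x => (b x).2) @ F --> v.2.
  by move: bv; case: (v) => v1 v2 bv; apply: cvg_comp bv _; exact: cvg_snd.
exact: cvgB (cvgM a1 b2) (cvgM a2 b1).
Qed.

Lemma enorm_gt0 (u : R * R) : u != 0 -> 0 < enorm u.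
Proof.
case: u => a b u0; rewrite /enorm sqrtr_gt0 /= lt_def addr_ge0 ?sqr_ge0// andbT.
rewrite paddr_eq0 ?sqr_ge0// !sqrf_eq0; apply: contra u0 => /andP[/eqP -> /eqP ->] //.
Qed.

Lemma det2_gt0_neq0 (u v : R * R) : 0 < det2 u v -> u != 0.
Proof.
by move=> uv; apply/eqP => u0; move: uv; rewrite u0 /det2 /= !mul0r subrr ltxx.
Qed.

Lemma det2_perturb (u v x y : R * R) :
  `|det2 (u + x) (v + y) - det2 u v| <= 2 * `|x| * (`|v| + `|y|) + 2 * `|u| * `|y|.
Proof.
have -> : det2 (u + x) (v + y) - det2 u v = det2 x (v + y) + det2 u y.
  by rewrite /det2 /=; ring.
apply: (le_trans (ler_normD _ _)); apply: lerD; last exact: det2_le.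
by apply: (le_trans (det2_le _ _)); rewrite ler_wpM2l ?mulr_ge0// ler_normD.
Qed.

Lemma det2_ge_perturb (u v x y : R * R) (b e B : R) : b <= det2 u v ->
  `|x| <= e -> `|y| <= e -> `|u| <= B -> `|v| <= B -> e <= 1 -> e * (4 * B + 2) < b ->
  0 < det2 (u + x) (v + y).
Proof.
move=> uv xe ye uB vB e1 eb; have := det2_perturb u v x y.
rewrite ler_norml => /andP[+ _]; have x0 := normr_ge0 x; have y0 := normr_ge0 y.
have u0 := normr_ge0 u; have v0 := normr_ge0 v.
have : 2 * `|x| * (`|v| + `|y|) + 2 * `|u| * `|y| <= e * (4 * B + 2).
  have -> : e * (4 * B + 2) = 2 * e * (B + 1) + 2 * B * e by ring.
  apply: lerD; apply: ler_pM; rewrite ?mulr_ge0 ?addr_ge0 ?ler_pM2l//.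
  by apply: lerD => //; exact: le_trans e1.
lra.
Qed.

Lemma periodic_min (a : R -> R) : continuous a -> (forall t, a (t + 2 * pi) = a t) ->
  (forall t, 0 < a t) -> exists2 b, 0 < b & forall t, b <= a t.
Proof.
move=> ca pa a0.
have [c _ cmin] := EVT_min (ltW pi2_gt0) (continuous_subspaceT ca).
exists (a c) => // t; have [n] := circle_lift t.
rewrite /circle /= in_itv /= => /andP[l u]; rewrite -(@periodicZ _ _ a n t) //.
by apply: cmin; rewrite in_itv /= l ltW.
Qed.

Local Opaque derive1 det2.

(** The last two hypotheses are stable under C^2-small perturbations, because
    they say that continuous functions are positive on compact sets, whereas the convexity of the
    curve says that a function vanishing on the diagonal is positive elsewhere.
    Close to the diagonal its positivity follows from the first hypothesis by
    applying the mean value theorem twice. *)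
Lemma is_table_criterion h (d : R) : closed_curve h -> 0 < d ->
  (forall t s, `|s| <= d -> 0 < det2 (D 1 h t) (D 2 h (t + s))) ->
  (forall t s, d <= s <= 2 * pi - d -> 0 < det2 (D 1 h t) (h (t + s) - h t)) ->
  is_table h.
Proof.
move=> [sh ph] d0 near far.
have turn t : 0 < det2 (D 1 h t) (D 2 h t).
  by have := near t 0; rewrite normr0 addr0; apply; exact: ltW.
have left_near t s : s != 0 -> `|s| < d -> 0 < det2 (D 1 h t) (h (t + s) - h t).
  move=> s0 sd.
  pose phi k y := det2 (D 1 h t) (D k h y - if k is 0%N then h t else 0).
  have dphi k y : is_derive y 1 (phi k) (phi k.+1 y).
    by rewrite /phi subr0; exact: is_derive_det2r.
  have cphi k : continuous (phi k).
    by move=> y; apply/differentiable_continuous/derivable1_diffP; case: (dphi k y).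
  have phi0 : phi 0%N t = 0 by rewrite /phi /= subrr det2v0.
  have phi1 : phi 1%N t = 0 by rewrite /phi subr0 det2vv.
  have phi2 y : `|y - t| <= d -> 0 < phi 2%N y.
    move=> yt; have := near t (y - t) yt.
    have -> : t + (y - t) = y by rewrite addrC subrK.
    by rewrite /phi subr0.
  (* phi vanishes to second order at t and is convex near t *)
  suff : 0 < phi 0%N (t + s) by [].
  move: phi dphi cphi phi0 phi1 phi2 => phi dphi cphi phi0 phi1 phi2.
  clear - dphi cphi phi0 phi1 phi2 s0 sd d0.
  have [s1|s1] : t + s < t \/ t < t + s.
  - by rewrite gtrDl ltrDl; apply/orP; rewrite -neq_lt.
  - have [c + Ec] := MVT s1 (fun y _ => dphi 0%N y) (continuous_subspaceT (cphi 0%N)).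
    rewrite in_itv /= => /andP[sc ct].
    have [e + Ee] := MVT ct (fun y _ => dphi 1%N y) (continuous_subspaceT (cphi 1%N)).
    rewrite in_itv /= => /andP[ce et].
    have {}phi2 : 0 < phi 2%N e.
      by apply: phi2; move: sd; rewrite ltr_norml ler_norml => /andP[]; lra.
    have p1 : 0 < phi 1%N t - phi 1%N c by rewrite Ee mulr_gt0// subr_gt0.
    rewrite phi1 sub0r in p1.
    have := mulr_gt0 p1 (_ : 0 < t - (t + s)).
    by rewrite mulNr -Ec phi0 sub0r opprK; apply; rewrite subr_gt0.
  - have [c + Ec] := MVT s1 (fun y _ => dphi 0%N y) (continuous_subspaceT (cphi 0%N)).
    rewrite in_itv /= => /andP[tc cs].
    have [e + Ee] := MVT tc (fun y _ => dphi 1%N y) (continuous_subspaceT (cphi 1%N)).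
    rewrite in_itv /= => /andP[te ec].
    have {}phi2 : 0 < phi 2%N e.
      by apply: phi2; move: sd; rewrite ltr_norml ler_norml => /andP[]; lra.
    have p1 : 0 < phi 1%N c - phi 1%N t by rewrite Ee mulr_gt0// subr_gt0.
    rewrite phi1 subr0 in p1.
    have := mulr_gt0 p1 (_ : 0 < t + s - t).
    by rewrite -Ec phi0 subr0; apply; rewrite subr_gt0.
have left t s : 0 < s < 2 * pi -> 0 < det2 (D 1 h t) (h (t + s) - h t).
  move=> /andP[s0 s1]; have [sd|sd] := ltP s d.
    by apply: left_near; [rewrite gt_eqF|rewrite gtr0_norm].
  have [sd'|sd'] := leP s (2 * pi - d); first by apply: far; rewrite sd.
  have -> : h (t + s) = h (t + (s - 2 * pi)) by rewrite -[RHS]ph -addrA subrK.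
  by apply: left_near; [rewrite lt_eqF// subr_lt0|
    rewrite ltr0_norm ?subr_lt0// opprB ltrBlDr addrC -ltrBlDr].
split => //.
- by move=> t; exact: det2_gt0_neq0 (turn t).
- move=> x y; rewrite !inE /circle /= !in_itv /= => /andP[x0 x1] /andP[y0 y1].
  wlog xy : x y x0 x1 y0 y1 / x < y => [wl|].
    have [xy|xy|//] := ltgtP x y; first exact: wl.
    by move=> /esym hxy; apply/esym; exact: wl.
  move=> hxy; have := left x (y - x).
  rewrite [x + _]addrC subrK hxy subrr det2v0 ltxx => H; exfalso.
  suff : false by []; apply: H.
  by apply/andP; split; clear -x0 y1 xy; lra.
- move=> _ [s _ <-] t; have [n] := circle_lift (s - t).
  rewrite /circle /= in_itv /= => /andP[n0 n1].
  have -> : h s = h (t + (s - t + n%:~R * (2 * pi))).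
    by rewrite addrA [t + _]addrC subrK periodicZ.
  move: n0; rewrite le_eqVlt => /orP[/eqP <-|n0]; first by rewrite addr0 subrr det2v0.
  by apply: ltW; apply: left; rewrite n0.
- move=> t; apply: divr_gt0; first exact: turn.
  by rewrite exprn_gt0// enorm_gt0//; exact: det2_gt0_neq0 (turn t).
Qed.


Lemma strictly_left_far (g : table R) (d : R) : 0 < d ->
  exists2 b, 0 < b & forall t s, d <= s <= 2 * pi - d ->
    b <= det2 (D 1 g t) (g (t + s) - g t).
Proof.
move=> d0; have [sg pg] := table_closed g.
pose A := `[0, 2 * pi : R]%classic `*` `[d, 2 * pi - d]%classic.
pose F (x : R * R) := det2 (D 1 g x.1) (g (x.1 + x.2) - g x.1).
have Fpos t s : d <= s <= 2 * pi - d -> 0 < F (t, s).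
  move=> /andP[ds sd]; apply: strictly_left => /curve_inj H.
  suff : t + s = t by clear -ds d0 => ?; lra.
  apply: H; rewrite [t + s]addrC addrK.
  by clear -ds d0 sd; rewrite ger0_norm; lra.
have cF : continuous F.
  move=> x; rewrite /F; apply: cvg_det2.
    apply: (@cvg_comp _ _ _ fst (D 1 g) _ (nbhs x.1)); first exact: cvg_fst.
    exact: (smooth_cont (k := 1) sg (x := x.1)).
  apply: cvgB.
    apply: (@cvg_comp _ _ _ (fun x : R * R => x.1 + x.2) g _ (nbhs (x.1 + x.2))).
      apply: cvgD; [exact: cvg_fst|exact: cvg_snd].
    exact: (smooth_cont (k := 0) sg (x := x.1 + x.2)).
  apply: (@cvg_comp _ _ _ fst g _ (nbhs x.1)); first exact: cvg_fst.
  exact: (smooth_cont (k := 0) sg (x := x.1)).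
have [dpi|dpi] := leP d (2 * pi - d); last first.
  exists 1 => // t s /andP[ds sd]; exfalso; clear -dpi ds sd.
  by have := le_lt_trans (le_trans ds sd) dpi; rewrite ltxx.
have A0 : A !=set0.
  by exists (0, d); split => /=; rewrite in_itv /= lexx ?dpi// ltW// pi2_gt0.
have cA : compact A by apply: compact_setX; exact: segment_compact.
have [[t0 s0] + mint] := compact_EVT_min A0 cA (continuous_subspaceT cF).
rewrite inE => -[_ /=]; rewrite in_itv /= => s0d.
exists (F (t0, s0)) => [|t s sd]; first exact: Fpos.
have [n] := circle_lift t; rewrite /circle /= in_itv /= => /andP[l u].
have -> : det2 (D 1 g t) (g (t + s) - g t) = F (t + n%:~R * (2 * pi), s).
  set t' := t + n%:~R * (2 * pi).
  rewrite -[F _]/(det2 (D 1 g t') (g (t' + s) - g t')) /t'.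
  rewrite (periodicZ n t (fun x => derive_periodic 1 x pg)).
  by rewrite addrAC !(periodicZ _ _ pg).
apply: mint; rewrite inE; split => /=; rewrite in_itv /=; last exact: sd.
by rewrite l (ltW u).
Qed.

Lemma table_perturb (g : table R) : exists2 e : R, 0 < e &
  forall V, closed_curve V -> (forall j t, (j <= 2)%N -> `|D j V t| <= e) ->
  is_table (fun t => g t + V t).
Proof.
have cg := table_closed g; have [sg pg] := cg.
have [M0 M00 M0P] := closed_bounded 0 cg.
have [M1 M10 M1P] := closed_bounded 1 cg.
have [M2 M20 M2P] := closed_bounded 2 cg.
have [M3 M30 M3P] := closed_bounded 3 cg.
have [k k0 kP] : exists2 k, 0 < k & forall t, k <= det2 (D 1 g t) (D 2 g t).
  apply: periodic_min => [t|t|t].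
  - by apply: cvg_det2; exact: smooth_cont.
  - by rewrite !derive_periodic.
  - exact: turning_gt0.
pose B := M0 + M0 + M1 + M2 + 1.
have B0 : 0 < B by rewrite /B; clear -M00 M10 M20; lra.
pose d := k / (4 * M1 * M3).
have d0 : 0 < d by rewrite divr_gt0// !mulr_gt0.
have [b b0 bP] := strictly_left_far g d0.
pose e := Num.min 1 (Num.min (k / 2) b / (2 * (8 * B + 4))).
have mn0 : 0 < Num.min (k / 2) b by rewrite lt_min b0 divr_gt0.
have den0 : 0 < 2 * (8 * B + 4) by clear -B0; lra.
have e0 : 0 < e by rewrite lt_min ltr01 divr_gt0.
have e1 : e <= 1 by rewrite ge_min lexx.
have eb : e * (8 * B + 4) < Num.min (k / 2) b.
  have : e * (2 * (8 * B + 4)) <= Num.min (k / 2) b.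
    by rewrite -ler_pdivlMr// ge_min lexx orbT.
  move: (Num.min (k / 2) b) mn0 => m; clear -e0 B0; nra.
exists (e / 2) => [|V cV Ve]; first by rewrite divr_gt0.
have e2 : e / 2 + e / 2 = e by field.
have sV := cV.1.
apply: (is_table_criterion (d := d) (closedD cg cV)) => // t s sd.
- rewrite (derive1nD 1 sg sV) (derive1nD 2 sg sV).
  apply: (@det2_ge_perturb _ _ _ _ (k / 2) e B).
  + have -> : D 2 g (t + s) = D 2 g t + (D 2 g (t + s) - D 2 g t) by rewrite [RHS]addrC subrK.
    rewrite det2Dr.
    have lip := curve_lipschitz (t + s) t sg M3P.
    have ts : t + s - t = s by rewrite addrC addKr.
    rewrite ts in lip.
    have := det2_le (D 1 g t) (D 2 g (t + s) - D 2 g t).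
    have : 2 * `|D 1 g t| * `|D 2 g (t + s) - D 2 g t| <= 2 * M1 * (M3 * d).
      apply: ler_pM; [by rewrite mulr_ge0|by []|by rewrite ler_pM2l//; exact: M1P|].
      by apply: (le_trans lip); rewrite ler_pM2l.
    have -> : 2 * M1 * (M3 * d) = k / 2.
      by rewrite /d; field; rewrite !gt_eqF.
    move: (kP t) (2 * _ * _) (det2 _ (_ - _)) => kt y x yk; rewrite ler_norml => /andP[+ _].
    move: kt; move: (det2 _ _) => z; clear -yk; lra.
  + apply: (le_trans (Ve 1%N t _)) => //; clear -e0; lra.
  + apply: (le_trans (Ve 2%N _ _)) => //; clear -e0; lra.
  + by apply: (le_trans (M1P t)); rewrite /B; clear -M00 M10 M20; lra.
  + by apply: (le_trans (M2P _)); rewrite /B; clear -M00 M10 M20; lra.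
  + by [].
  + apply: (@le_lt_trans _ _ (e * (8 * B + 4))).
      by rewrite ler_pM2l//; clear -B0; lra.
    by apply: (lt_le_trans eb); rewrite ge_min lexx.
- rewrite (derive1nD 1 sg sV).
  have -> : g (t + s) + V (t + s) - (g t + V t) = (g (t + s) - g t) + (V (t + s) - V t).
    by rewrite opprD addrACA.
  apply: (@det2_ge_perturb _ _ _ _ b e B).
  + exact: bP.
  + apply: (le_trans (Ve 1%N t _)) => //; clear -e0; lra.
  + apply: (le_trans (ler_normB _ _)); rewrite -e2; apply: lerD; exact: (Ve 0%N).
  + by apply: (le_trans (M1P t)); rewrite /B; clear -M00 M10 M20; lra.
  + apply: (le_trans (ler_normB _ _)).
    apply: (le_trans (lerD (M0P (t + s)) (M0P t))).
    by rewrite /B; clear -M00 M10 M20; lra.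
  + by [].
  + apply: (@le_lt_trans _ _ (e * (8 * B + 4))).
      by rewrite ler_pM2l//; clear -B0; lra.
    by apply: (lt_le_trans eb); rewrite ge_min lexx orbT.
Qed.

End Stability.

(** * A counting argument in place of dimension theory *)
Section Pigeonhole.
Context {R : realType}.

(** There is no map tau from an (m+1)-dimensional cube to an m-dimensional box
    whose inverse is Lipschitz: its values on a grid of M^(m+1) points of the
    cube would lie in distinct cells of a grid of the box with at most
    (M * (L + 1))^m cells, where L does not depend on M. *)
Lemma no_expanding_section (m : nat) (I : finType) (r s A : R) (c : 'I_m -> R)
    (tau : (I -> R) -> 'I_m -> R) :
  (m < #|I|)%N -> 0 < r -> 0 <= A ->
  (forall x, (forall i, 0 <= x i <= r) -> forall a, `|tau x a - c a| <= s) ->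
  (forall x y, (forall i, 0 <= x i <= r) -> (forall i, 0 <= y i <= r) ->
    forall e, (forall a, `|tau x a - tau y a| <= e) -> forall i, `|x i - y i| <= A * e) ->
  False.
Proof.
move=> mI r0 A0 bnd expd.
(* The cells have side 1 / (M K). Points of the cube over a common cell are at a
   distance of at most A / (M K) < r / M, the mesh of the grid of the cube, and
   M (L + 1) cells cover an interval of length 2 s. *)
pose K := (Num.bound (A / r)).+1; pose L := Num.bound (2 * s * K%:R).
pose M := (L.+1 ^ m).+1.
have M0 : 0 < M%:R :> R by rewrite ltr0n.
have K0 : 0 < K%:R :> R by rewrite ltr0n.
have KA : A / r < K%:R.
  apply: (le_lt_trans (ler_norm _)); apply: (lt_trans (archi_boundP (normr_ge0 _))).
  by rewrite /K (_ : Num.bound `|A / r| = Num.bound (A / r)) ?ltr_nat// ger0_norm// divr_ge0// ltW.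
pose grid (k : {ffun I -> 'I_M}) (i : I) : R := r * (k i)%:R / M%:R.
have gridP k i : 0 <= grid k i <= r.
  apply/andP; split; first by rewrite divr_ge0// mulr_ge0// ltW.
  by rewrite /grid ler_pdivrMr// ler_pM2l// ler_nat ltnW.
pose pos k a : R := (tau (grid k) a - c a + s) * (M * K)%:R.
have pos_ge0 k a : 0 <= pos k a.
  rewrite mulr_ge0//; have := bnd _ (gridP k) a; rewrite ler_norml => /andP[].
  by clear; lra.
have cellP k a : (Num.truncn (pos k a) < M * L.+1)%N.
  rewrite -(ltr_nat R); have /andP[h _] := truncn_itv (pos_ge0 k a).
  apply: (le_lt_trans h); rewrite /pos !natrM mulrCA ltr_pM2l//.
  have := bnd _ (gridP k) a; rewrite ler_norml => /andP[_ h1].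
  apply: (@le_lt_trans _ _ (2 * s * K%:R)).
    by rewrite ler_pM2r//; clear -h1; lra.
  have s0 : 0 <= s by apply: le_trans (bnd _ (gridP k) a).
  apply: (lt_trans (archi_boundP _)); first by rewrite !mulr_ge0// ltW.
  by rewrite ltr_nat.
pose cell k : {ffun 'I_m -> 'I_(M * L.+1)} := [ffun a => Ordinal (cellP k a)].
have cell_inj : injective cell.
  move=> k l kl; apply/ffunP => i; apply/eqP; apply/contraT => kli.
  have e0 a : `|tau (grid k) a - tau (grid l) a| <= ((M * K)%:R)^-1.
    have : Num.truncn (pos k a) = Num.truncn (pos l a).
      by have /ffunP/(_ a) := kl; rewrite !ffunE => /(congr1 val).
    have /andP[k1 k2] := truncn_itv (pos_ge0 k a).
    have /andP[l1 l2] := truncn_itv (pos_ge0 l a).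
    move=> E; rewrite E in k1 k2.
    have MK0 : 0 < (M * K)%:R :> R by rewrite natrM mulr_gt0.
    rewrite -(ler_pM2r MK0) mulVf ?gt_eqF// -{1}(gtr0_norm MK0) -normrM.
    have -> : (tau (grid k) a - tau (grid l) a) * (M * K)%:R = pos k a - pos l a.
      by rewrite /pos; ring.
    move: k1 k2 l1 l2; rewrite -natr1 ler_norml; move: (_%:R) => z.
    by move: (pos k a) (pos l a) => u v; clear => ? ? ? ?; apply/andP; split; lra.
  have := expd _ _ (gridP k) (gridP l) _ e0 i.
  have -> : grid k i - grid l i = r / M%:R * ((k i)%:R - (l i)%:R).
    by rewrite /grid; field; rewrite gt_eqF.
  rewrite normrM gtr0_norm ?divr_gt0//.
  have d1 : 1 <= `|(k i)%:R - (l i)%:R| :> R.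
    have : (k i : nat) != l i by [].
    rewrite neq_ltn => /orP[] h.
      by rewrite distrC ger0_norm ?subr_ge0 ?ler_nat 1?ltnW// lerBrDr addrC natr1 ler_nat.
    by rewrite ger0_norm ?subr_ge0 ?ler_nat 1?ltnW// lerBrDr addrC natr1 ler_nat.
  move=> h; have : r / M%:R <= A / (M * K)%:R.
    by apply: le_trans h; rewrite ler_peMr// divr_ge0// ltW.
  rewrite natrM [M%:R * _]mulrC invfM mulrA ler_pM2r ?invr_gt0//.
  by move: KA; rewrite ltr_pdivrMr// mulrC => KA; rewrite ler_pdivlMr// leNgt KA.
have := leq_card cell cell_inj; rewrite !card_ffun !card_ord expnMn.
apply/negP; rewrite -ltnNge.
apply: (@leq_trans (M ^ m.+1)); last by rewrite leq_pexp2l.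
by rewrite expnS mulnC ltn_pmul2r ?expn_gt0// ltnS.
Qed.

End Pigeonhole.

(** * Interpolation by trigonometric polynomials *)
Section TrigPolynomials.
Context {R : realType}.
Implicit Types (f g : R -> R) (t c M N : R).
Local Notation D := (@derive1n R R).

(** A class that contains the interpolants below, and for which closure under
    differentiation, hence smoothness, and periodicity follow by induction. *)
Inductive trig_poly : (R -> R) -> Prop :=
| trig_cst c : trig_poly (fun=> c)
| trig_sin c : trig_poly (fun t => sin (t - c))
| trig_cos c : trig_poly (fun t => cos (t - c))
| trig_add f g : trig_poly f -> trig_poly g -> trig_poly (fun t => f t + g t)
| trig_mul f g : trig_poly f -> trig_poly g -> trig_poly (fun t => f t * g t).

Lemma is_derive_sin_shift c t : is_derive t 1 (fun t => sin (t - c)) (cos (t - c)).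
Proof.
have d : is_derive t 1 (fun t => t - c) 1.
  by have := is_deriveB (is_derive_id t 1) (is_derive_cst c t 1); rewrite subr0.
have := @is_derive1_comp R sin (fun t => t - c) t _ _ (is_derive_sin (t - c)) d.
by rewrite mulr1.
Qed.

Lemma is_derive_cos_shift c t : is_derive t 1 (fun t => cos (t - c)) (- sin (t - c)).
Proof.
have d : is_derive t 1 (fun t => t - c) 1.
  by have := is_deriveB (is_derive_id t 1) (is_derive_cst c t 1); rewrite subr0.
have := @is_derive1_comp R cos (fun t => t - c) t _ _ (is_derive_cos (t - c)) d.
by rewrite mulr1.
Qed.

Lemma is_derive_mul f g (f' g' : R) t : is_derive t 1 f f' -> is_derive t 1 g g' ->
  is_derive t 1 (fun t => f t * g t) (f' * g t + f t * g').
Proof.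
move=> df dg; have H := is_deriveM df dg.
by refine (is_derive_eq H _); rewrite /GRing.scale /=; ring.
Qed.

Lemma is_derive_add f g (f' g' : R) t : is_derive t 1 f f' -> is_derive t 1 g g' ->
  is_derive t 1 (fun t => f t + g t) (f' + g').
Proof. by move=> df dg; exact: (is_deriveD df dg). Qed.

Lemma trig_derivative f : trig_poly f ->
  exists2 f', trig_poly f' & forall t, is_derive t 1 f (f' t).
Proof.
elim=> [c|c|c|{}f g tf [f' tf' df] tg [g' tg' dg]|{}f g tf [f' tf' df] tg [g' tg' dg]].
- by exists (fun=> 0); [exact: trig_cst|move=> t; exact: is_derive_cst].
- by exists (fun t => cos (t - c)); [exact: trig_cos|exact: is_derive_sin_shift].
- exists (fun t => (-1) * sin (t - c)); first by apply: trig_mul; [exact: trig_cst|exact: trig_sin].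
  by move=> t; rewrite mulN1r; exact: is_derive_cos_shift.
- by exists (fun t => f' t + g' t); [exact: trig_add|move=> t; exact: is_derive_add].
- exists (fun t => f' t * g t + f t * g' t); last by move=> t; exact: is_derive_mul.
  by apply: trig_add; exact: trig_mul.
Qed.

Lemma trig_derive1 f : trig_poly f ->
  trig_poly f^`() /\ forall t, is_derive t 1 f (f^`() t).
Proof.
move=> /trig_derivative[f' tf' df].
have E : f^`() = f' by apply/funext => t; rewrite derive1E; exact: derive_val.
by rewrite E.
Qed.

Lemma trig_derive1n f k : trig_poly f -> trig_poly (D k f).
Proof. by move=> tf; elim: k => [//|k IH]; case: (trig_derive1 IH). Qed.

Lemma trig_is_derive f k t : trig_poly f -> is_derive t 1 (D k f) (D k.+1 f t).
Proof. by move=> tf; case: (trig_derive1 (trig_derive1n k tf)). Qed.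

Lemma trig_periodic f t : trig_poly f -> f (t + 2 * pi) = f t.
Proof.
elim=> [//|c|c|{}f g _ + _ +|{}f g _ + _ +].
- by rewrite addrAC mulr_natl sinD2pi.
- by rewrite addrAC mulr_natl cosD2pi.
- by move=> -> ->.
- by move=> -> ->.
Qed.

Lemma trig_curve f (v : R * R) : trig_poly f ->
  closed_curve (fun t => f t *: v) /\
  forall k t, derive1n k (fun t => f t *: v) t = D k f t *: v.
Proof.
move=> tf.
have E k : derive1n k (fun t => f t *: v) = (fun t => D k f t *: v).
  elim: k => [//|k IH]; rewrite derive1nS IH; apply: derive_eq_fun => t.
  exact: (is_derive_scalel v (trig_is_derive k t tf)).
split=> [|k t]; last by rewrite E.
split=> [k t|t]; last by rewrite trig_periodic.
by rewrite E; case: (is_derive_scalel v (trig_is_derive k t tf)).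
Qed.

(** M bounds f and its first two derivatives. *)
Definition trig_bound M f :=
  trig_poly f /\ forall k t, (k <= 2)%N -> `|D k f t| <= M.

Lemma trig_bound_mul M N f g : 0 <= M -> 0 <= N -> trig_bound M f -> trig_bound N g ->
  trig_bound (4 * (M * N)) (fun t => f t * g t).
Proof.
move=> M0 N0 [tf bf] [tg bg]; split; first exact: trig_mul.
have E1 : D 1 (fun t => f t * g t) = (fun t => D 1 f t * D 0 g t + D 0 f t * D 1 g t).
  apply: derive_eq_fun => t.
  by apply: is_derive_mul; [exact: (trig_is_derive 0)|exact: (trig_is_derive 0)].
have E2 : D 2 (fun t => f t * g t) = (fun t => (D 2 f t * D 0 g t + D 1 f t * D 1 g t)
    + (D 1 f t * D 1 g t + D 0 f t * D 2 g t)).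
  rewrite derive1nS E1; apply: derive_eq_fun => t.
  by apply: is_derive_add; apply: is_derive_mul;
    [exact: (trig_is_derive 1)|exact: (trig_is_derive 0)
    |exact: (trig_is_derive 0)|exact: (trig_is_derive 1)].
have b i j t : (i <= 2)%N -> (j <= 2)%N -> `|D i f t * D j g t| <= M * N.
  by move=> i2 j2; rewrite normrM ler_pM ?bf ?bg.
have MN : 0 <= M * N by rewrite mulr_ge0.
have MN4 : M * N + M * N + (M * N + M * N) = 4 * (M * N) by ring.
have sum2 (a c d e : R) : `|a| <= d -> `|c| <= e -> `|a + c| <= d + e.
  by move=> ad ce; apply: (le_trans (ler_normD _ _)); exact: lerD.
move=> [|[|[|//]]] t _.
- apply: (le_trans (b 0%N 0%N t isT isT)).
  by rewrite ler_peMl// ler1n.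
- rewrite E1; apply: (@le_trans _ _ (M * N + M * N)); last by rewrite -MN4 lerDl addr_ge0.
  by apply: sum2; exact: b.
- rewrite E2; apply: (@le_trans _ _ (M * N + M * N + (M * N + M * N))); last by rewrite MN4.
  by apply: (sum2 _ _ _ _ _ _); apply: (sum2 _ _ _ _ _ _); exact: b.
Qed.

Lemma cos_shift_bound c : trig_bound 2 (fun t => 1 - cos (t - c)).
Proof.
split.
  have -> : (fun t => 1 - cos (t - c)) = (fun t => 1 + (-1) * cos (t - c)).
    by apply/funext => t; rewrite mulN1r.
  by apply: trig_add; [exact: trig_cst|apply: trig_mul; [exact: trig_cst|exact: trig_cos]].
have E1 : D 1 (fun t => 1 - cos (t - c)) = (fun t => sin (t - c)).
  apply: derive_eq_fun => t.
  have := is_deriveB (is_derive_cst (1 : R) t 1) (is_derive_cos_shift c t).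
  by rewrite sub0r opprK.
have E2 : D 2 (fun t => 1 - cos (t - c)) = (fun t => cos (t - c)).
  by rewrite derive1nS E1; apply: derive_eq_fun => t; exact: is_derive_sin_shift.
move=> [|[|[|//]]] t _.
- rewrite -[D 0 _ t]/(1 - cos (t - c)) ger0_norm ?subr_ge0 ?cos_le1//.
  by have := cos_geN1 (t - c); lra.
- by rewrite E1; apply: (le_trans (sin_max _)); rewrite ler1n.
- by rewrite E2; apply: (le_trans (cos_max _)); rewrite ler1n.
Qed.

Lemma sin_shift_bound c : trig_bound 1 (fun t => sin (t - c)).
Proof.
split; first exact: trig_sin.
have E1 : D 1 (fun t => sin (t - c)) = (fun t => cos (t - c)).
  by apply: derive_eq_fun => t; exact: is_derive_sin_shift.
have E2 : D 2 (fun t => sin (t - c)) = (fun t => - sin (t - c)).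
  by rewrite derive1nS E1; apply: derive_eq_fun => t; exact: is_derive_cos_shift.
move=> [|[|[|//]]] t _.
- exact: sin_max.
- by rewrite E1 cos_max.
- by rewrite E2 normrN sin_max.
Qed.

Lemma prod_bound (I : Type) (r : seq I) (P : pred I) (c : I -> R) :
  trig_bound (8 ^+ size r) (fun t => \prod_(i <- r | P i) (1 - cos (t - c i))).
Proof.
have cst1 : trig_bound 1 (fun=> 1).
  split; first exact: trig_cst.
  have E k : D k.+1 (fun=> 1 : R) = cst 0.
    elim: k => [|k IH]; last first.
      by rewrite derive1nS IH; apply: derive_eq_fun => t; exact: is_derive_cst.
    by apply: derive_eq_fun => t; exact: is_derive_cst.
  by move=> [|k] t _; rewrite ?E ?normr1 ?normr0.
elim: r => [|i r IH].
  by have -> : (fun t => \prod_(i <- [::] | P i) (1 - cos (t - c i))) = (fun=> 1)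
    by apply/funext => t; rewrite big_nil.
have [Pi|nPi] := boolP (P i); last first.
  have -> : (fun t => \prod_(i <- i :: r | P i) (1 - cos (t - c i))) =
    (fun t => \prod_(i <- r | P i) (1 - cos (t - c i))).
    by apply/funext => t; rewrite big_cons (negbTE nPi).
  case: IH => tp bp; split=> // k t k2; apply: (le_trans (bp k t k2)).
  by rewrite /= exprS ler_peMl// ?exprn_ge0// ler1n.
have -> : (fun t => \prod_(i <- i :: r | P i) (1 - cos (t - c i))) =
  (fun t => (1 - cos (t - c i)) * \prod_(i <- r | P i) (1 - cos (t - c i))).
  by apply/funext => t; rewrite big_cons Pi.
have -> : 8 ^+ size (i :: r) = 4 * (2 * 8 ^+ size r) :> R.
  by rewrite /= exprS mulrA -natrM.
by apply: trig_bound_mul => //; exact: cos_shift_bound.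
Qed.

End TrigPolynomials.

Section Interpolation.
Context {R : realType}.
Variables (m : nat) (T : 'I_m -> R).
Implicit Types (a b : 'I_m) (t : R).

(** [node a] is nonzero at T a and vanishes to second order at the other nodes:
    it moves the point with parameter T a. [slope a] vanishes at all nodes, and
    its derivative at all of them but T a: it turns the tangent at T a. *)
Definition node a t : R := \prod_(b | b != a) (1 - cos (t - T b)).
Definition slope a t : R := sin (t - T a) * node a t.

Lemma node_bound a : trig_bound (8 ^+ m) (node a).
Proof.
have := prod_bound (index_enum 'I_m) (fun b => b != a) T.
by rewrite -sum1_size sum_nat_const card_ord muln1.
Qed.

Lemma slope_bound a : trig_bound (4 * 8 ^+ m) (slope a).
Proof.
have := trig_bound_mul ler01 (exprn_ge0 _ _) (sin_shift_bound (T a)) (node_bound a).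
by rewrite mul1r; apply.
Qed.

Lemma node_other a b : b != a -> node a (T b) = 0.
Proof. by move=> ba; rewrite /node (bigD1 b)//= subrr cos0 subrr mul0r. Qed.

Lemma node_ge0 a t : 0 <= node a t.
Proof. by apply: prodr_ge0 => b _; rewrite subr_ge0 cos_le1. Qed.

Lemma node_self_ge a (k : R) : 0 <= k <= 1 ->
  (forall b, b != a -> k <= 1 - cos (T a - T b)) -> k ^+ m <= node a (T a).
Proof.
move=> /andP[k0 k1] kT; rewrite /node big_mkcond /=.
have -> : k ^+ m = \prod_(b < m) k by rewrite prodr_const card_ord.
apply: ler_prod => b _; rewrite k0 /=; case: ifP => // ba; exact: kT.
Qed.

Lemma slope_node a b : slope a (T b) = 0.
Proof.
have [->|ba] := eqVneq b a; first by rewrite /slope subrr sin0 mul0r.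
by rewrite /slope node_other// mulr0.
Qed.

(** [node a] is nonnegative, so that its zeros are critical points. *)
Lemma slope_derive a b : (slope a)^`() (T b) = if b == a then node a (T a) else 0.
Proof.
have [tn _] := node_bound a.
have := is_derive_mul (is_derive_sin_shift (T a) (T b)) (trig_is_derive 0 (T b) tn).
rewrite derive1E => /@derive_val ->.
have [->|ba] := eqVneq b a; first by rewrite subrr cos0 sin0 mul1r mul0r addr0.
rewrite -[derive1n 0 _ _]/(node a (T b)) node_other// mulr0 add0r.
have -> : derive1n 1 (node a) (T b) = 0; last by rewrite mulr0.
apply: (derive_at_min (fun t => trig_is_derive 0 t tn)) => t.
by rewrite -[derive1n 0 _ _]/(node a (T b)) node_other// node_ge0.
Qed.

End Interpolation.

(** * The response of the equations to a perturbation *)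
Section LinearEstimate.
Context {R : realType}.

Lemma subrACA (V : zmodType) (a b c d : V) : (a - b) - (c - d) = (a - c) - (b - d).
Proof. by rewrite !opprB [d - c]addrC [d - b]addrC addrACA. Qed.

Lemma subrBD (V : zmodType) (a b c : V) : a - (b - c) = a - b + c.
Proof. by rewrite opprB addrCA addrC. Qed.

Lemma det2_node_expand (d d' f f' w : R * R) (x : R) :
  x * det2 d' w =
  det2 (d - d') f + det2 d' (f - f' + x *: w) - (det2 d f - det2 d' f').
Proof. by rewrite !det2Dr det2Dl !det2Nr det2Nl det2Zr; ring. Qed.

Lemma det2_slope_expand (d d' z z' w : R * R) (x : R) :
  x * det2 w d = det2 z d - det2 z' d' - det2 (z - z' - x *: w) d - det2 z' (d - d').
Proof. by rewrite !det2Dl !det2Nl det2Dr det2Nr det2Zl; ring. Qed.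

Lemma estimate_arith (c S e B r M : R) :
  c * (c * S) <= (c + 6 * M * B ^+ 2) * (e + 8 * B * r * S) + c * M * (e + 6 * B * r * S) ->
  r * (8 * B * (c + 6 * M * B ^+ 2) + 6 * B * c * M) * S <= c ^+ 2 / 2 * S ->
  S * c ^+ 2 <= 2 * (c + 6 * M * B ^+ 2 + c * M) * e.
Proof. by rewrite !expr2 => h1 h2; lra. Qed.

Lemma big_option_split (I : finType) (V : zmodType) (F : option I -> V) :
  \sum_j F j = F None + \sum_a F (Some a).
Proof.
rewrite (bigD1 None)//=; congr (_ + _).
rewrite (reindex_omap Some id) => [|[a|]//] /=.
by apply: eq_bigl => a; rewrite eqxx.
Qed.

Lemma norm_sum_scale_le (I : finType) (P : pred I) (x : I -> R) (W : I -> R * R) (r : R) :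
  (forall j, P j -> `|W j| <= r) -> 0 <= r ->
  `|\sum_(j | P j) x j *: W j| <= r * \sum_j `|x j|.
Proof.
move=> Wr r0; apply: (le_trans (ler_norm_sum _ _ _)).
rewrite mulr_sumr big_mkcond /=; apply: ler_sum => j _.
case: ifP => Pj; last by rewrite mulr_ge0.
by rewrite normrZ mulrC ler_wpM2r// Wr.
Qed.

Variables (m : nat) (p q : 'I_m -> 'I_m) (a0 p1 q1 : 'I_m).
Variables (Y Y' Z Z' : 'I_m -> R * R) (x : option 'I_m -> R).
Variables (P Q : option 'I_m -> 'I_m -> R * R) (B c r e : R).
Let S := \sum_j `|x j|.
Local Opaque det2.

Hypothesis p1_notin : p1 \notin [:: p a0; q a0; q1].
Hypothesis YE : forall b, Y b - Y' b = \sum_j x j *: P j b.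
Hypothesis ZE : forall b, Z b - Z' b = \sum_j x j *: Q j b.
Hypothesis P_small : forall a b, `|P (Some a) b| <= r.
Hypothesis PN_small : forall b, b != p1 -> `|P None b| <= r.
Hypothesis Q_small : forall a b, a != b -> `|Q (Some a) b| <= r.
Hypothesis PB : `|P None p1| <= B.
Hypothesis QB : forall b, `|Q None b| <= B.
Hypothesis YB : forall a, `|Y (q a) - Y (p a)| <= B.
Hypothesis YB1 : `|Y q1 - Y p1| <= B.
Hypothesis YB' : `|Y' (q a0) - Y' (p a0)| <= B.
Hypothesis ZB' : forall a, `|Z' a| <= B.
Hypothesis c_slope : forall a, c <= `|det2 (Q (Some a) a) (Y (q a) - Y (p a))|.
Hypothesis c_node : c <= `|det2 (Y' (q a0) - Y' (p a0)) (P None p1)|.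
Hypothesis e_slope : forall a,
  `|det2 (Z a) (Y (q a) - Y (p a)) - det2 (Z' a) (Y' (q a) - Y' (p a))| <= e.
Hypothesis e_node : `|det2 (Y (q a0) - Y (p a0)) (Y q1 - Y p1)
  - det2 (Y' (q a0) - Y' (p a0)) (Y' q1 - Y' p1)| <= e.
Hypothesis c0 : 0 < c.

Let B0 : 0 <= B. Proof. exact: le_trans PB. Qed.
Let r0 : 0 <= r. Proof. exact: le_trans (P_small a0 a0). Qed.
Let S0 : 0 <= S. Proof. exact: sumr_ge0. Qed.

Lemma det2_mul_le (u v : R * R) (b d : R) : `|u| <= b -> `|v| <= d ->
  `|det2 u v| <= 2 * b * d.
Proof.
move=> ub vd; apply: (le_trans (det2_le _ _)).
by apply: ler_pM; rewrite ?mulr_ge0// ler_pM2l.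
Qed.

Let Y_other b : b != p1 -> `|Y b - Y' b| <= r * S.
Proof.
move=> bp; rewrite YE; apply: norm_sum_scale_le => // -[a|] _; first exact: P_small.
exact: PN_small.
Qed.

Let Y_rest b : `|Y b - Y' b - x None *: P None b| <= r * S.
Proof.
rewrite YE (bigD1 None)//= addrAC subrr add0r.
by apply: norm_sum_scale_le => // -[a|//] _; exact: P_small.
Qed.

Let Y_all b : `|Y b - Y' b| <= r * S + B * `|x None|.
Proof.
have [->|bp] := eqVneq b p1; last first.
  by apply: (le_trans (Y_other bp)); rewrite lerDl mulr_ge0.
rewrite -[Y p1 - Y' p1](subrK (x None *: P None p1)).
apply: (le_trans (ler_normD _ _)); apply: lerD; first exact: Y_rest.
by rewrite normrZ mulrC ler_wpM2r.
Qed.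

Let Z_rest a : `|Z a - Z' a - x (Some a) *: Q (Some a) a| <= r * S + B * `|x None|.
Proof.
rewrite ZE (bigD1 (Some a))//= addrAC subrr add0r (bigD1 None)//= addrC.
apply: (le_trans (ler_normD _ _)); apply: lerD; last by rewrite normrZ mulrC ler_wpM2r.
apply: norm_sum_scale_le => // -[b|]; last by rewrite andbF.
by rewrite andbT => ba; apply: Q_small; apply: contraNneq ba => ->.
Qed.

Let node_estimate : c * `|x None| <= e + 8 * B * r * S.
Proof.
move: p1_notin; rewrite !inE !negb_or => /and3P[n1 n2 n3].
have en := e_node; have cn := c_node; have yb' := YB'; have yb1 := YB1.
set d := Y (q a0) - Y (p a0) in en *; set d' := Y' (q a0) - Y' (p a0) in en cn yb' *.
set f := Y q1 - Y p1 in en yb1 *; set f' := Y' q1 - Y' p1 in en *.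
have dd : `|d - d'| <= 2 * (r * S).
  have -> : d - d' = (Y (q a0) - Y' (q a0)) - (Y (p a0) - Y' (p a0)).
    exact: subrACA.
  apply: (le_trans (ler_normB _ _)); rewrite mulr_natl mulr2n.
  by apply: lerD; apply: Y_other; rewrite eq_sym.
pose s := (Y q1 - Y' q1) - (Y p1 - Y' p1 - x None *: P None p1).
have sS : `|s| <= 2 * (r * S).
  apply: (le_trans (ler_normB _ _)); rewrite mulr_natl mulr2n.
  by apply: lerD; [apply: Y_other; rewrite eq_sym|exact: Y_rest].
have E : x None * det2 d' (P None p1) = det2 (d - d') f + det2 d' s - (det2 d f - det2 d' f').
  have -> : s = f - f' + x None *: P None p1.
    by rewrite /s subrBD subrACA.
  exact: det2_node_expand.
have : `|x None| * c <= `|x None * det2 d' (P None p1)|.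
  by rewrite normrM ler_wpM2l.
rewrite mulrC => /le_trans; apply; rewrite E.
apply: (le_trans (ler_normB _ _)); rewrite addrC; apply: lerD => //.
apply: (le_trans (ler_normD _ _)).
have -> : 8 * B * r * S = 2 * (2 * (r * S)) * B + 2 * B * (2 * (r * S)) by ring.
by apply: lerD; exact: det2_mul_le.
Qed.

Let slope_estimate a : c * `|x (Some a)| <= e + 6 * B * (r * S + B * `|x None|).
Proof.
set w := r * S + B * `|x None|.
set d := Y (q a) - Y (p a); set d' := Y' (q a) - Y' (p a).
have dd : `|d - d'| <= 2 * w.
  have -> : d - d' = (Y (q a) - Y' (q a)) - (Y (p a) - Y' (p a)).
    exact: subrACA.
  apply: (le_trans (ler_normB _ _)); rewrite mulr_natl mulr2n.
  by apply: lerD; exact: Y_all.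
pose s := Z a - Z' a - x (Some a) *: Q (Some a) a.
have E : x (Some a) * det2 (Q (Some a) a) d =
    det2 (Z a) d - det2 (Z' a) d' - det2 s d - det2 (Z' a) (d - d').
  exact: det2_slope_expand.
have : `|x (Some a)| * c <= `|x (Some a) * det2 (Q (Some a) a) d|.
  by rewrite normrM ler_wpM2l.
rewrite mulrC => /le_trans; apply; rewrite E -addrA.
apply: (le_trans (ler_normD _ _)); apply: lerD => //.
rewrite -opprD normrN; apply: (le_trans (ler_normD _ _)).
have -> : 6 * B * w = 2 * w * B + 2 * B * (2 * w) by ring.
apply: lerD; first exact: (det2_mul_le (Z_rest a) (YB a)).
by rewrite ?normrN; exact: (det2_mul_le (ZB' a) dd).
Qed.

(** Y, Z and Y', Z' are the positions and velocities at m given parameters for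
    two perturbed curves, x is the difference of the two perturbation
    parameters, and P j b, Q j b are the displacement and the change of
    velocity at the point b caused by the parameter j. Up to terms of size r
    the system is triangular: the parallelism of the two chords at a0 depends
    on x None only, and then the equation at a depends on x (Some a) only. *)
Lemma linear_estimate :
  r * (8 * B * (c + 6 * m%:R * B ^+ 2) + 6 * B * c * m%:R) <= c ^+ 2 / 2 ->
  S <= 2 * (c + 6 * m%:R * B ^+ 2 + c * m%:R) / c ^+ 2 * e.
Proof.
move=> small; set N := `|x None|.
have sumS : c * S <= c * N + m%:R * (e + 6 * B * (r * S + B * N)).
  have -> : m%:R * (e + 6 * B * (r * S + B * N)) =
      \sum_(a < m) (e + 6 * B * (r * S + B * N)).
    by rewrite sumr_const card_ord mulr_natl.
  rewrite {1}/S big_option_split mulrDr lerD2l mulr_sumr.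
  by apply: ler_sum => a _; exact: (slope_estimate a).
have N1 := node_estimate; rewrite -/N in N1.
have m0 : 0 <= m%:R :> R by [].
have K0 : 0 <= c + 6 * m%:R * B ^+ 2 by apply: addr_ge0; [exact: ltW|rewrite !mulr_ge0// exprn_ge0].
have h1 : c * (c * S) <= (c + 6 * m%:R * B ^+ 2) * (e + 8 * B * r * S)
    + c * m%:R * (e + 6 * B * r * S).
  apply: (@le_trans _ _ (c * (c * N + m%:R * (e + 6 * B * (r * S + B * N))))).
    by rewrite ler_pM2l.
  have -> : c * (c * N + m%:R * (e + 6 * B * (r * S + B * N))) =
    (c + 6 * m%:R * B ^+ 2) * (c * N) + c * m%:R * (e + 6 * B * r * S) by ring.
  by rewrite lerD2r ler_wpM2l.
have h2 : r * (8 * B * (c + 6 * m%:R * B ^+ 2) + 6 * B * c * m%:R) * S <= c ^+ 2 / 2 * S.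
  by rewrite ler_wpM2r.
have c2 : 0 < c ^+ 2 by rewrite exprn_gt0.
rewrite mulrAC ler_pdivlMr//.
exact: estimate_arith h1 h2.
Qed.

End LinearEstimate.

(** * Perturbing away the solutions near a given one *)
Section Perturbation.
Context {R : realType}.
Implicit Types (f g h : R -> R * R) (t : R).
Local Notation D := (@derive1n R (R * R)%type).

Lemma det2_dist (u v u' v' : R * R) (b d b' d' : R) :
  `|u - u'| <= b' -> `|v| <= d -> `|u'| <= b -> `|v - v'| <= d' ->
  `|det2 u v - det2 u' v'| <= 2 * b' * d + 2 * b * d'.
Proof.
move=> uu vd ub vv.
have -> : det2 u v - det2 u' v' = det2 (u - u') v + det2 u' (v - v').
  by rewrite det2Dl det2Nl det2Dr det2Nr; ring.
by apply: (le_trans (ler_normD _ _)); apply: lerD; exact: det2_mul_le.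
Qed.

Lemma triangle_half (c u v r : R) : 2 * c <= `|u| -> `|v + u| <= r -> r <= c -> c <= `|v|.
Proof.
move=> cu vur rc; have : `|u| <= `|v| + `|v + u|.
  by rewrite -{1}[u](addKr v) (le_trans (ler_normD _ _))// normrN.
by move=> h; lra.
Qed.

Lemma det2_rot_abs (d : R * R) (k : R) : 0 <= k -> k <= `|d| -> k ^+ 2 <= `|det2 d (rot d)|.
Proof.
move=> k0 kd; apply: (@le_trans _ _ (`|d| ^+ 2)); first by rewrite ler_pXn2r// nnegrE.
by apply: (le_trans (det2_rot_ge d)); exact: ler_norm.
Qed.

Variables (m : nat).
Implicit Types (p q : 'I_m -> 'I_m) (T tau : 'I_m -> R) (x y : option 'I_m -> R).

(** The equation at a0 for the second chord is replaced by the parallelism of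
    the two chords at a0, in which no velocity occurs. *)
Definition config g p q (a0 p1 q1 : 'I_m) tau :=
  (forall a, det2 (g^`() (tau a)) (g (tau (q a)) - g (tau (p a))) = 0) /\
  det2 (g (tau (q a0)) - g (tau (p a0))) (g (tau q1) - g (tau p1)) = 0.

(** Closed conditions on g and tau; for given g and given distinct points, they
    hold as soon as k is large enough. *)
Definition nondegenerate (k : R) g p q tau :=
  [/\ forall t, `|g t| <= k /\ `|g^`() t| <= k,
      forall a b, b != a -> k^-1 <= 1 - cos (tau a - tau b) &
      forall a, k^-1 <= `|g (tau (q a)) - g (tau (p a))|].

(** The perturbations are orthogonal to the chords whose equations they are to
    violate: the determinants that measure their effect are then squared
    lengths of chords. *)
Definition direction g p q (a0 p1 : 'I_m) T (j : option 'I_m) t : R * R :=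
  if j is Some a then slope T a t *: rot (g (T (q a)) - g (T (p a)))
  else node T p1 t *: rot (g (T (q a0)) - g (T (p a0))).

Local Opaque derive1 det2.

(** [vec_bound k] bounds all positions, chords, velocities and perturbations
    that occur in a k-nondegenerate system and its perturbations; [det_bound k]
    bounds from below the determinants that measure the effect of each
    perturbation on its own equation, and is half of the bound that holds at
    the nodes. *)
Definition vec_bound (k : R) : R := 2 * k * (4 * 8 ^+ m) + 4 * k.
Definition det_bound (k : R) : R := (k^-1) ^+ (m + 2) / 2.

Lemma vec_bound_ge (k : R) : 1 <= k ->
  [/\ 4 * k <= vec_bound k, 1 <= vec_bound k & 2 * k * (4 * 8 ^+ m) <= vec_bound k].
Proof.
move=> k1; have k0 : 0 <= k by exact: le_trans k1.
have h : 0 <= 2 * k * (4 * 8 ^+ m) by rewrite !mulr_ge0// exprn_ge0.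
rewrite /vec_bound; split; [by rewrite lerDr| |by rewrite lerDl mulr_ge0].
by move: h; move: (2 * k * _) => z z0; lra.
Qed.

Lemma det_bound_gt0 (k : R) : 1 <= k -> 0 < det_bound k.
Proof. by move=> k1; rewrite divr_gt0// exprn_gt0// invr_gt0 (lt_le_trans ltr01). Qed.

Lemma direction_closed g p q (a0 p1 : 'I_m) T j : closed_curve (direction g p q a0 p1 T j).
Proof.
case: j => [a|] /=.
- by case: (trig_curve (rot (g (T (q a)) - g (T (p a)))) (proj1 (slope_bound T a))).
- by case: (trig_curve (rot (g (T (q a0)) - g (T (p a0)))) (proj1 (node_bound T p1))).
Qed.

Lemma direction_bound (k : R) g p q (a0 p1 : 'I_m) T j i t :
  1 <= k -> nondegenerate k g p q T -> (i <= 2)%N ->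
  `|D i (direction g p q a0 p1 T j) t| <= vec_bound k.
Proof.
move=> k1 [gk _ _] i2; have k0 : 0 <= k by exact: le_trans k1.
have [_ _ hB] := vec_bound_ge k1; apply: le_trans hB.
have dk a b : `|rot (g (T a) - g (T b))| <= 2 * k.
  rewrite norm_rot; apply: (le_trans (ler_normB _ _)); rewrite mulr_natl mulr2n.
  by apply: lerD; case: (gk (T a)); case: (gk (T b)).
case: j => [a|] /=; rewrite mulrC.
- have [tp bd] := slope_bound T a.
  have [_ ->] := trig_curve (rot (g (T (q a)) - g (T (p a)))) tp.
  by rewrite normrZ; apply: ler_pM => //; exact: bd.
- have [tp bd] := node_bound T p1.
  have [_ ->] := trig_curve (rot (g (T (q a0)) - g (T (p a0)))) tp.
  rewrite normrZ; apply: ler_pM => //; apply: (le_trans (bd _ _ i2)).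
  by rewrite ler_peMl ?exprn_ge0// ler1n.
Qed.

Section AtNodes.
Variables (k d : R) (g : R -> R * R) (p q : 'I_m -> 'I_m) (a0 p1 : 'I_m) (T tau : 'I_m -> R).
Hypotheses (k1 : 1 <= k) (gT : nondegenerate k g p q T).
Hypothesis near : forall a, `|tau a - T a| <= d.
Let P := direction g p q a0 p1 T.
Let B := vec_bound k.

Lemma direction_lipschitz j i b : (i <= 1)%N -> `|D i (P j) (tau b) - D i (P j) (T b)| <= B * d.
Proof.
move=> i1; apply: (@le_trans _ _ (B * `|tau b - T b|)).
  apply: curve_lipschitz; first exact: (direction_closed g p q a0 p1 T j).1.
  by move=> t; exact: direction_bound.
by apply: ler_wpM2l => //; apply: le_trans ler01 _; case: (vec_bound_ge k1).
Qed.

Lemma slope_small a b : `|P (Some a) (tau b)| <= B * d.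
Proof.
have := @direction_lipschitz (Some a) 0 b isT.
by rewrite -[D 0 _ (T b)]/(slope T a (T b) *: _) slope_node scale0r subr0.
Qed.

Lemma node_small b : b != p1 -> `|P None (tau b)| <= B * d.
Proof.
move=> bp; have := @direction_lipschitz None 0 b isT.
by rewrite -[D 0 _ (T b)]/(node T p1 (T b) *: _) node_other// scale0r subr0.
Qed.

Lemma dslope_node a b :
  D 1 (P (Some a)) (T b) =
  (if b == a then node T a (T a) else 0) *: rot (g (T (q a)) - g (T (p a))).
Proof.
have [tp _] := slope_bound T a.
have [_ E] := trig_curve (rot (g (T (q a)) - g (T (p a)))) tp.
by rewrite -slope_derive; exact: E.
Qed.

Lemma dslope_small a b : a != b -> `|D 1 (P (Some a)) (tau b)| <= B * d.
Proof.
move=> ab; have := @direction_lipschitz (Some a) 1 b isT.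
by rewrite dslope_node eq_sym (negbTE ab) scale0r subr0.
Qed.

Variable E : 'I_m -> R * R.
Hypothesis gE : forall b, `|E b - g (T b)| <= B * d / 2.
Hypothesis small : 4 * B ^+ 2 * d <= det_bound k.

Let kV0 : 0 <= k^-1. Proof. by rewrite invr_ge0; apply: le_trans k1. Qed.
Let kV1 : k^-1 <= 1. Proof. by rewrite invf_le1// (lt_le_trans ltr01). Qed.

Let chord_dist a b : `|(E a - E b) - (g (T a) - g (T b))| <= B * d.
Proof.
rewrite subrACA; apply: (le_trans (ler_normB _ _)).
have -> : B * d = B * d / 2 + B * d / 2 by field.
exact: lerD.
Qed.

Let node_ge a : (k^-1) ^+ m <= node T a (T a).
Proof.
by apply: node_self_ge; [rewrite kV0|move=> b; case: gT => _ h _; exact: h].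
Qed.

Let main_ge a b :
  2 * det_bound k <= `|node T a (T a) *
    det2 (g (T (q b)) - g (T (p b))) (rot (g (T (q b)) - g (T (p b))))|.
Proof.
rewrite normrM.
have -> : 2 * det_bound k = (k^-1) ^+ m * (k^-1) ^+ 2.
  by rewrite /det_bound exprD; field; rewrite gt_eqF// (lt_le_trans ltr01).
apply: ler_pM; rewrite ?exprn_ge0//.
- by apply: le_trans (node_ge a) _; exact: ler_norm.
- by apply: det2_rot_abs => //; case: gT.
Qed.

Let B0 : 0 <= B. Proof. by apply: le_trans ler01 _; case: (vec_bound_ge k1). Qed.

Let chord_le a b : `|g (T a) - g (T b)| <= B.
Proof.
have [B4 _ _] := vec_bound_ge k1; apply: le_trans B4; apply: (le_trans (ler_normB _ _)).
have [gk _ _] := gT.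
have := proj1 (gk (T a)); have := proj1 (gk (T b)); have := k1.
by move: `|_| => z; move: `|_| => z' *; lra.
Qed.

Lemma slope_main a : `|E (q a) - E (p a)| <= B ->
  det_bound k <= `|det2 (D 1 (P (Some a)) (tau a)) (E (q a) - E (p a))|.
Proof.
move=> EB.
have := @det2_dist (D 1 (P (Some a)) (tau a)) (E (q a) - E (p a))
  (D 1 (P (Some a)) (T a)) (g (T (q a)) - g (T (p a))) B B (B * d) (B * d)
  (@direction_lipschitz (Some a) 1 a isT) EB (@direction_bound _ _ _ _ _ _ _ _ 1 _ k1 gT isT)
  (chord_dist _ _).
have := main_ge a a.
rewrite dslope_node eqxx det2Zl [det2 (rot _) _]det2C mulrN opprK.
move=> h1 h2; apply: (triangle_half h1 h2).
by apply: le_trans small; rewrite expr2 le_eqVlt; apply/orP; left; apply/eqP; ring.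
Qed.

Lemma node_main : `|E (q a0) - E (p a0)| <= B ->
  det_bound k <= `|det2 (E (q a0) - E (p a0)) (P None (tau p1))|.
Proof.
move=> EB.
have := @det2_dist (E (q a0) - E (p a0)) (P None (tau p1)) (g (T (q a0)) - g (T (p a0)))
  (P None (T p1)) B B (B * d) (B * d) (chord_dist _ _)
  (@direction_bound _ _ _ _ _ _ _ None 0 _ k1 gT isT) (chord_le _ _)
  (@direction_lipschitz None 0 p1 isT).
have := main_ge p1 a0.
rewrite -[P None (T p1)]/(node T p1 (T p1) *: _) det2Zr.
rewrite -normrN => h1 h2; apply: (triangle_half h1 h2).
by apply: le_trans small; rewrite expr2 le_eqVlt; apply/orP; left; apply/eqP; ring.
Qed.

End AtNodes.
End Perturbation.

Section PerturbedCurves.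
Context {R : realType}.
Local Notation D := (@derive1n R (R * R)%type).
Variable m : nat.
Implicit Types (p q : 'I_m -> 'I_m) (T tau : 'I_m -> R) (x y : option 'I_m -> R).
Local Opaque derive1 det2.

Definition radius_den (k : R) : R :=
  let B := vec_bound m k in let c := det_bound m k in
  B * (8 * B * (c + 6 * m%:R * B ^+ 2) + 6 * B * c * m%:R).

(** The three bounds make, respectively, a perturbation no larger than k, the
    loss on the main determinants at most one half, and the coupling of the
    equations small enough for [linear_estimate]. *)
Definition radius (k : R) : R :=
  Num.min 1 (Num.min (det_bound m k / (4 * (vec_bound m k) ^+ 2))
                     (det_bound m k ^+ 2 / 2 / (radius_den k + 1))).

Lemma radiusP k : 1 <= k -> [/\ 0 < radius k, radius k <= 1,
  4 * (vec_bound m k) ^+ 2 * radius k <= det_bound m k &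
  vec_bound m k * radius k * (8 * vec_bound m k * (det_bound m k + 6 * m%:R * vec_bound m k ^+ 2)
     + 6 * vec_bound m k * det_bound m k * m%:R) <= det_bound m k ^+ 2 / 2].
Proof.
move=> k1; have c0 := @det_bound_gt0 R m k k1; have [_ B1 _] := @vec_bound_ge R m k k1.
have B0 : 0 < vec_bound m k by exact: lt_le_trans B1.
have den0 : 0 <= radius_den k.
  have B0' := ltW B0; have c0' := ltW c0.
  rewrite /radius_den; move: (vec_bound m k) (det_bound m k) B0' c0' => u v u0 v0.
  by repeat (apply: mulr_ge0 || apply: addr_ge0 || apply: exprn_ge0).
have den1 : 0 < radius_den k + 1 by rewrite ltr_wpDl.
have B20 : 0 < 4 * vec_bound m k ^+ 2 by rewrite mulr_gt0// exprn_gt0.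
have c20 : 0 < det_bound m k ^+ 2 / 2 by rewrite divr_gt0// exprn_gt0.
have d0 : 0 < radius k.
  by rewrite !lt_min ltr01 /=; apply/andP; split; exact: divr_gt0.
split=> //.
- by rewrite ge_min lexx.
- by rewrite mulrC -ler_pdivlMr// !ge_min lexx orbT.
- rewrite mulrAC -[X in X * _ <= _]/(vec_bound m k * _) -/(radius_den k).
  have : radius k * (radius_den k + 1) <= det_bound m k ^+ 2 / 2.
    by rewrite -ler_pdivlMr// !ge_min lexx !orbT.
  by rewrite mulrDr mulr1 mulrC => h; apply: le_trans h; rewrite lerDl ltW.
Qed.

Variables (k : R) (g : table R) (p q : 'I_m -> 'I_m) (a0 p1 q1 : 'I_m) (T : 'I_m -> R).
Hypotheses (k1 : 1 <= k) (p1_notin : p1 \notin [:: p a0; q a0; q1]).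
Hypothesis gT : nondegenerate k g p q T.
Let P := direction g p q a0 p1 T.
Let B := vec_bound m k.
Let c := det_bound m k.
Let d := radius k.

Let V x t := \sum_j x j *: P j t.
Let h x t := g t + V x t.

Let closedP j : closed_curve (P j) := direction_closed g p q a0 p1 T j.

Let V_closed x : closed_curve (V x).
Proof. exact: (closed_sum (index_enum _) x 0 closedP).1. Qed.

Let DV x i t : D i (V x) t = \sum_j x j *: D i (P j) t.
Proof.
have sF j : smooth (fun t => x j *: P j t) by exact: (smoothZ (c := x j) (closedP j).1).
have [_ E] := smooth_sum (index_enum _) sF.
rewrite /V E; apply: eq_bigr => j _.
by rewrite (derive1nZ (x j) i (closedP j).1).
Qed.

Let Dh x i t : D i (h x) t = D i g t + D i (V x) t.
Proof. by rewrite /h (derive1nD i (table_closed g).1 (V_closed x).1). Qed.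

Let h_sub x y i t : D i (h x) t - D i (h y) t = \sum_j (x j - y j) *: D i (P j) t.
Proof.
rewrite !Dh !DV opprD addrACA subrr add0r -sumrB.
by apply: eq_bigr => j _; rewrite scalerBl.
Qed.

Variables (G : R).
Definition small_move x :=
  is_table (h x) /\ forall i t, (i <= 2)%N -> `|D i (V x) t| <= d.
Hypothesis gG : forall t, `|D 2 g t| <= G.

Let B4 : 4 * k <= B. Proof. by case: (@vec_bound_ge R m k k1). Qed.
Let B0 : 0 <= B. Proof. by case: (@vec_bound_ge R m k k1) => _ B1 _; apply: le_trans ler01 B1. Qed.
Let d0 : 0 < d. Proof. by case: (radiusP k1). Qed.
Let d1 : d <= 1. Proof. by case: (radiusP k1). Qed.

Let h_bound x i t : small_move x -> (i <= 1)%N -> `|D i (h x) t| <= 2 * k.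
Proof.
move=> [_ sx] i1; rewrite Dh; apply: (le_trans (ler_normD _ _)).
rewrite mulr_natl mulr2n; apply: lerD; last first.
  by apply: (le_trans (sx i t _)); [exact: leq_trans i1 _|exact: le_trans d1 k1].
have [gk _ _] := gT; have [g0 g1] := gk t.
case: i i1 => [_|[_|i i1]].
- exact g0.
- exact g1.
- exact (False_ind _ (Bool.diff_false_true i1)).
Qed.

Let h_chord x s t : small_move x -> `|h x s - h x t| <= B.
Proof.
move=> sx; apply: le_trans B4; apply: (le_trans (ler_normB _ _)).
have h1 := h_bound s sx (i := 0) isT; have h2 := h_bound t sx (i := 0) isT.
by apply: (le_trans (lerD h1 h2)); rewrite -mulrDl; lra.
Qed.

Let h_vel x t : small_move x -> `|D 1 (h x) t| <= B.
Proof.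
move=> sx; apply: (le_trans (h_bound t sx (i := 1) isT)); apply: le_trans B4.
by rewrite ler_wpM2r ?ler_nat// (le_trans ler01).
Qed.

Let h_near x tau b : small_move x -> (forall a, `|tau a - T a| <= d) ->
  `|h x (tau b) - g (T b)| <= B * d / 2.
Proof.
move=> [_ sx] near; rewrite /h addrAC.
apply: (le_trans (ler_normD _ _)).
apply: (@le_trans _ _ (k * d + d)).
  apply: lerD; last exact: (sx 0%N).
  apply: (@le_trans _ _ (k * `|tau b - T b|)); last by rewrite ler_wpM2l// (le_trans ler01).
  apply: (curve_lipschitz (k := 0) _ _ (table_closed g).1) => t.
  by have [gk _ _] := gT; case: (gk t).
have -> : B * d / 2 = B / 2 * d by ring.
have -> : k * d + d = (k + 1) * d by ring.
rewrite ler_pM2r// ler_pdivlMr//; apply: le_trans B4.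
by have := k1; lra.
Qed.

Let h_lip x s t : small_move x -> `|h x s - h x t| <= B * `|s - t|.
Proof.
move=> sx; apply: (curve_lipschitz (k := 0) _ _ (closedD (table_closed g) (V_closed x)).1) => u.
exact: (h_vel u sx).
Qed.

Let h_lip1 x s t : small_move x -> `|D 1 (h x) s - D 1 (h x) t| <= (G + 1) * `|s - t|.
Proof.
move=> [_ sx]; apply: (curve_lipschitz (k := 1) _ _ (closedD (table_closed g) (V_closed x)).1) => u.
rewrite Dh; apply: (le_trans (ler_normD _ _)); apply: lerD => //.
by apply: (le_trans (sx 2%N u isT)).
Qed.

Definition expansion : R :=
  2 * (c + 6 * m%:R * B ^+ 2 + c * m%:R) / c ^+ 2 * (2 * (G + 1) * B + 8 * B ^+ 2).

(** Let the curves of parameters x and y solve the equations at tau and tau'.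
    At tau, the equations of the second curve are violated by at most a
    multiple of e, by Lipschitz continuity, while those of the first one hold;
    [linear_estimate] turns this into a bound for x - y. *)
Lemma expanding_zeros x y tau tau' e : small_move x -> small_move y ->
  (forall a, `|tau a - T a| <= d) ->
  config (h x) p q a0 p1 q1 tau -> config (h y) p q a0 p1 q1 tau' ->
  (forall a, `|tau a - tau' a| <= e) -> forall i, `|x i - y i| <= expansion * e.
Proof.
move=> sx sy near [cx cx1] [cy cy1] te i.
have G0 : 0 <= G + 1 by rewrite addr_ge0// (le_trans _ (gG 0)).
have [_ _ small1 small2] := radiusP k1.
have h_lipe x' a : small_move x' -> `|h x' (tau a) - h x' (tau' a)| <= B * e.
  by move=> sx'; apply: (le_trans (h_lip _ _ sx')); rewrite ler_wpM2l.
have h_lip1e x' a : small_move x' -> `|D 1 (h x') (tau a) - D 1 (h x') (tau' a)| <= (G + 1) * e.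
  by move=> sx'; apply: (le_trans (h_lip1 _ _ sx')); rewrite ler_wpM2l.
have chord_lip a b :
    `|(h y (tau a) - h y (tau b)) - (h y (tau' a) - h y (tau' b))| <= 2 * B * e.
  rewrite subrACA; apply: (le_trans (ler_normB _ _)).
  by rewrite -mulrA mulr_natl mulr2n; apply: lerD; exact: h_lipe.
have e0 : 0 <= e by apply: le_trans (te a0).
have est := @linear_estimate R m p q a0 p1 q1
  (fun b => h x (tau b)) (fun b => h y (tau b))
  (fun b => D 1 (h x) (tau b)) (fun b => D 1 (h y) (tau b))
  (fun j => x j - y j) (fun j b => P j (tau b)) (fun j b => D 1 (P j) (tau b))
  B c (B * d) ((2 * (G + 1) * B + 8 * B ^+ 2) * e) p1_notin.
have {est} : \sum_j `|x j - y j| <=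
    2 * (c + 6 * m%:R * B ^+ 2 + c * m%:R) / c ^+ 2 * ((2 * (G + 1) * B + 8 * B ^+ 2) * e).
  apply: est.
  - by move=> b; exact: (h_sub x y 0).
  - by move=> b; exact: (h_sub x y 1).
  - by move=> a b; exact: (slope_small a0 p1 k1 gT near).
  - by move=> b bp; exact: (node_small a0 k1 gT near bp).
  - by move=> a b ab; exact: (dslope_small a0 p1 k1 gT near ab).
  - exact: (direction_bound a0 p1 None _ k1 gT (i := 0)).
  - by move=> b; exact: (direction_bound a0 p1 None _ k1 gT (i := 1)).
  - by move=> a; exact: h_chord.
  - exact: h_chord.
  - exact: h_chord.
  - by move=> a; exact: h_vel.
  - move=> a; apply: (slope_main (E := fun b => h x (tau b)) a0 p1 k1 gT near) => //.
      by move=> b; exact: h_near.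
    exact: h_chord.
  - apply: (@node_main R m k d g p q a0 p1 T tau k1 gT near (fun b => h y (tau b))) => //.
      by move=> b; exact: h_near.
    exact: h_chord.
  - move=> a; rewrite [X in X - _](cx a) -(cy a) distrC.
    apply: (le_trans (det2_dist (h_lip1e y a sy) (h_chord _ _ sy) (h_vel _ sy) (chord_lip _ _))).
    have : 0 <= B ^+ 2 * e by rewrite mulr_ge0// exprn_ge0.
    by rewrite expr2; lra.
  - rewrite [X in X - _]cx1 -cy1 distrC.
    apply: (le_trans (det2_dist (chord_lip _ _) (h_chord _ _ sy) (h_chord _ _ sy) (chord_lip _ _))).
    have : 0 <= (G + 1) * B * e by rewrite !mulr_ge0.
    by rewrite expr2; lra.
  - exact: det_bound_gt0.
  - exact: small2.
rewrite mulrA; apply: le_trans.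
by rewrite (bigD1 i)//= lerDl sumr_ge0.
Qed.

End PerturbedCurves.

Section PerturbAway.
Context {R : realType}.
Local Notation D := (@derive1n R (R * R)%type).
Local Opaque derive1 det2.

(** Otherwise every parameter in a small (m+1)-dimensional cube has a solution
    tau within the m-dimensional box around T, and [expanding_zeros] makes tau
    a map that [no_expanding_section] forbids. *)
Lemma perturb_away_configs (m : nat) (k : R) (g : table R) (p q : 'I_m -> 'I_m)
    (a0 p1 q1 : 'I_m) (T : 'I_m -> R) (K : nat) (e : R) :
  1 <= k -> p1 \notin [:: p a0; q a0; q1] -> nondegenerate k g p q T -> 0 < e ->
  exists h : table R, Ckball g K e h /\
    forall tau, (forall a, `|tau a - T a| <= radius m k) ->
    ~ config h p q a0 p1 q1 tau.
Proof.
move=> k1 p1n gT e0; apply: contrapT => nokill.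
pose P := direction g p q a0 p1 T.
have closedP j : closed_curve (P j) := direction_closed g p q a0 p1 T j.
pose V (x : option 'I_m -> R) t := \sum_j x j *: P j t.
pose K' := maxn K 2.
pose N := \sum_j Cknorm K' (P j).
have N0 : 0 <= N by apply: sumr_ge0 => j _; exact: Cknorm_ge0.
have N1 : 0 < N + 1 by rewrite ltr_wpDl.
have [e1 e10 tab] := table_perturb g.
have [d0 _ _ _] := @radiusP R m k k1.
set d := radius m k in d0 *.
pose w := Num.min e (Num.min e1 d).
have w0 : 0 < w by rewrite lt_min e0 lt_min e10.
(* For x in the cube of side r, all perturbations have C^K'-norm below w. *)
pose r := w / (N + 1).
have r0 : 0 < r by rewrite divr_gt0.
have rN : r * N < w.
  by rewrite /r mulrAC ltr_pdivrMr// ltr_pM2l// ltrDl.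
pose cube (x : option 'I_m -> R) := forall j, 0 <= x j <= r.
have VN x : cube x -> closed_curve (V x) /\ Cknorm K' (V x) < w.
  move=> cx; have [cV nV] := closed_sum (index_enum _) x K' closedP; split=> //.
  apply: le_lt_trans rN; apply: (le_trans nV); rewrite mulr_sumr.
  apply: ler_sum => j _; rewrite ler_wpM2r ?Cknorm_ge0//.
  by have /andP[x0 xr] := cx j; rewrite ger0_norm.
have sm x : cube x -> small_move k g p q a0 p1 T x.
  move=> cx; have [cV nV] := VN x cx.
  have b i t : (i <= 2)%N -> `|D i (V x) t| <= w.
    move=> i2; apply: le_trans (ltW nV); apply: Cknorm_ge => //.
    exact: leq_trans i2 (leq_maxr _ _).
  split; last first.
    by move=> i t i2; apply: (le_trans (b i t i2)); rewrite ge_min ge_min [d <= _]lexx !orbT.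
  by apply: tab => // i t i2; apply: (le_trans (b i t i2)); rewrite ge_min ge_min lexx !orbT.
have bad x : exists tau : 'I_m -> R, cube x ->
    (forall a, `|tau a - T a| <= radius m k) /\
    config (fun t => g t + V x t) p q a0 p1 q1 tau.
  have [cx|ncx] := pselect (cube x); last by exists T.
  apply: contrapT => nobad; apply: nokill.
  have [tx _] := sm x cx; have [cV nV] := VN x cx.
  exists (Table tx); split.
    rewrite /Ckball /=.
    have -> : (fun t => g t + V x t - g t) = V x by apply/funext => t; rewrite addrC addKr.
    apply: (@le_lt_trans _ _ (Cknorm K' (V x))); first by apply: Cknorm_le; exact: leq_maxl.
    by apply: (lt_le_trans nV); rewrite ge_min lexx.
  by move=> tau near conf; apply: nobad; exists tau.
have [tau tauP] := choice bad.
have [G G0 GP] := closed_bounded 2 (table_closed g).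
apply: (@no_expanding_section R m (option 'I_m) r (radius m k) (expansion m k G) T tau) => //.
- by rewrite card_option card_ord.
- rewrite /expansion; have c0 := ltW (@det_bound_gt0 R m k k1).
  have [_ B1 _] := @vec_bound_ge R m k k1; have B0 := le_trans ler01 B1.
  move: (vec_bound m k) (det_bound m k) B0 c0 => u v u0 v0.
  have {}G0 := ltW G0.
  by repeat (apply: mulr_ge0 || apply: addr_ge0 || apply: exprn_ge0 || rewrite invr_ge0).
- by move=> x cx; case: (tauP x cx).
- move=> x y cx cy eta te i.
  have [nx kx] := tauP x cx; have [ny ky] := tauP y cy.
  exact: (expanding_zeros k1 p1n gT GP (sm x cx) (sm y cy) nx kx ky te).
Qed.

End PerturbAway.

(** * Openness, density and the generic tables *)
Section GenericTables.
Context {R : realType}.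
Local Notation D := (@derive1n R (R * R)%type).
Implicit Types (g h : table R).
Local Opaque derive1 det2.

Section Configurations.
Variables (m : nat) (k : R) (p q : 'I_m -> 'I_m) (a0 p1 q1 : 'I_m) (c : 'I_m -> R).
Hypothesis k1 : 1 <= k.

Definition has_config g := exists tau : 'I_m -> R,
  [/\ forall a, `|tau a - c a| <= radius m k / 2,
      nondegenerate k g p q tau & config g p q a0 p1 q1 tau].

(** Evaluation is jointly continuous in the table and in the parameter. *)
Lemma cvg_position g (v : 'rV[R]_m) b i : (i <= 1)%N ->
  (fun z : 'rV[R]_m * table R => D i z.2 (z.1 ord0 b)) @ filter_prod (nbhs v) (nbhs g)
    --> D i g (v ord0 b).
Proof.
move=> i1; apply/cvgrPdist_lt => e e0.
have e20 : 0 < e / 2 by rewrite divr_gt0.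
have cg : (fun w : 'rV[R]_m => D i g (w ord0 b)) @ v --> D i g (v ord0 b).
  apply: (@cvg_comp _ _ _ (fun w : 'rV[R]_m => w ord0 b) (D i g) _ (nbhs (v ord0 b))).
    exact: coord_continuous.
  exact: (smooth_cont (k := i) (table_closed g).1 (x := v ord0 b)).
have /cvgrPdist_lt/(_ _ e20) vg := cg.
exists ([set w : 'rV[R]_m | `|D i g (v ord0 b) - D i g (w ord0 b)| < e / 2],
        Ckball g 1 (e / 2)).
  by split; [exact: vg|exact: Ckball_nbhs].
move=> [w h] /= [gw gh].
have hw := Ckball_near (w ord0 b) gh i1.
rewrite -(subrKA (D i g (w ord0 b))).
apply: (le_lt_trans (ler_normD _ _)).
have -> : e = e / 2 + e / 2 by field.
by apply: ltrD => //; rewrite distrC.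
Qed.

Lemma config_stable g (v : 'rV[R]_m) :
  ~ (nondegenerate k g p q (v ord0) /\ config g p q a0 p1 q1 (v ord0)) ->
  filter_prod (nbhs v) (nbhs g) [set z : 'rV[R]_m * table R |
    ~ (nondegenerate k z.2 p q (z.1 ord0) /\ config z.2 p q a0 p1 q1 (z.1 ord0))].
Proof.
move=> ngood; set F := filter_prod _ _.
have FF : Filter F by exact: filter_prod_filter.
have chord_cvg a b : (fun z : 'rV[R]_m * table R => z.2 (z.1 ord0 a) - z.2 (z.1 ord0 b))
    @ F --> g (v ord0 a) - g (v ord0 b).
  by apply: cvgB; [exact: (@cvg_position g v a 0)|exact: (@cvg_position g v b 0)].
have value_cvg i t : (i <= 1)%N -> (fun z : 'rV[R]_m * table R => D i z.2 t) @ F --> D i g t.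
  move=> i1; apply/cvgrPdist_lt => e e0.
  exists (setT, Ckball g 1 e); first by split; [exact: filterT|exact: Ckball_nbhs].
  by move=> [w h] /= [_ gh]; rewrite distrC; exact: Ckball_near gh i1.
have cos_cvg a b : (fun z : 'rV[R]_m * table R => 1 - cos (z.1 ord0 a - z.1 ord0 b)) @ F
    --> 1 - cos (v ord0 a - v ord0 b).
  have cc a' : (fun z : 'rV[R]_m * table R => z.1 ord0 a') @ F --> v ord0 a'.
    apply: (@cvg_comp _ _ _ fst (fun w : 'rV[R]_m => w ord0 a') F (nbhs v)); first exact: cvg_fst.
    exact: coord_continuous.
  apply: cvgB; first exact: cvg_cst.
  apply: (@cvg_comp _ _ _ (fun z : 'rV[R]_m * table R => z.1 ord0 a - z.1 ord0 b) cos F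
    (nbhs (v ord0 a - v ord0 b))); first exact: cvgB.
  exact: continuous_cos.
have [[t kt]|b0] := pselect (exists t, k < `|D 0 g t|).
  have cl := cvgr_gt _ (cvg_norm (value_cvg 0%N t isT)) _ kt.
  apply: (@filterS _ F FF _ _ _ (cl _ _)) => z kz [[gk _ _] _].
  by have [g0 _] := gk t; have := lt_le_trans kz g0; rewrite ltxx.
have [[t kt]|b1] := pselect (exists t, k < `|D 1 g t|).
  have cl := cvgr_gt _ (cvg_norm (value_cvg 1%N t isT)) _ kt.
  apply: (@filterS _ F FF _ _ _ (cl _ _)) => z kz [[gk _ _] _].
  by have [_ g1] := gk t; have := lt_le_trans kz g1; rewrite ltxx.
have [[a [b [ba kt]]]|b2] := pselect (exists a b : 'I_m,
    b != a /\ 1 - cos (v ord0 a - v ord0 b) < k^-1).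
  have cl := cvgr_lt _ (cos_cvg a b) _ kt.
  apply: (@filterS _ F FF _ _ _ (cl _)) => z kz [[_ sk _] _].
  by have := lt_le_trans kz (sk a b ba); rewrite ltxx.
have [[a kt]|b3] := pselect (exists a : 'I_m, `|g (v ord0 (q a)) - g (v ord0 (p a))| < k^-1).
  have cl := cvgr_lt _ (cvg_norm (chord_cvg (q a) (p a))) _ kt.
  apply: (@filterS _ F FF _ _ _ (cl _ _)) => z kz [[_ _ ck] _].
  by have := lt_le_trans kz (ck a); rewrite ltxx.
have [[a kt]|b4] := pselect (exists a : 'I_m,
    det2 (D 1 g (v ord0 a)) (g (v ord0 (q a)) - g (v ord0 (p a))) != 0).
  have cl := cvgr_neq0 _ (cvg_det2 FF (@cvg_position g v a 1 isT) (chord_cvg (q a) (p a))) kt.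
  by apply: (@filterS _ F FF _ _ _ (cl _)) => z kz [_ [E _]]; move/eqP: kz; apply; exact: E.
have [kt|b5] := pselect (det2 (g (v ord0 (q a0)) - g (v ord0 (p a0)))
    (g (v ord0 q1) - g (v ord0 p1)) != 0).
  have cl := cvgr_neq0 _ (cvg_det2 FF (chord_cvg (q a0) (p a0)) (chord_cvg q1 p1)) kt.
  by apply: (@filterS _ F FF _ _ _ (cl _)) => z kz [_ [_ E]]; move/eqP: kz; apply; exact: E.
exfalso; apply: ngood; split; last split.
- split.
  + by move=> t; split; rewrite leNgt; apply/negP => h; [apply: b0|apply: b1]; exists t.
  + by move=> a b ba; rewrite leNgt; apply/negP => h; apply: b2; exists a, b.
  + by move=> a; rewrite leNgt; apply/negP => h; apply: b3; exists a.
- move=> a; apply: contrapT => h; apply: b4; exists a; exact/eqP.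
- by apply: contrapT => h; apply: b5; exact/eqP.
Qed.

(** By compactness of the box: each of its points has a neighbourhood without
    solution for all tables close to g. *)
Lemma no_config_open : open [set g | ~ has_config g].
Proof.
rewrite openE => g /= ng.
pose J a : set R := `[c a - radius m k / 2, c a + radius m k / 2]%classic.
pose K := [set w : 'rV[R]_m | forall a, J a (w ord0 a)].
have cK : compact K by apply: (@rV_compact R m J) => a; exact: segment_compact.
have /compact_near_coveringP cover := cK.
have Kg w : K w -> ~ (nondegenerate k g p q (w ord0) /\ config g p q a0 p1 q1 (w ord0)).
  move=> Kw [nd cf]; apply: ng; exists (w ord0); split=> // a.
  have := Kw a; rewrite /J /= in_itv /= => /andP[l u].
  by rewrite ler_norml lerBlDl lerBrDl u l.
have near := cover (table R) (nbhs g)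
  (fun h w => ~ (nondegenerate k h p q (w ord0) /\ config h p q a0 p1 q1 (w ord0))) _
  (fun w Kw => config_stable (Kg w Kw)).
have Fg : Filter (nbhs g) by exact: nbhs_filter.
apply: (@filterS _ (nbhs g) Fg _ _ _ (near Fg)) => h hK [tau [nt nd cf]].
have := hK (\row_a tau a); have -> : (\row_a tau a) ord0 = tau by apply/funext => a; rewrite mxE.
apply; last by split.
move=> a; rewrite /J /= in_itv /= mxE.
by have := nt a; rewrite ler_norml lerBlDl lerBrDl => /andP[-> ->].
Qed.

Lemma no_config_dense : p1 \notin [:: p a0; q a0; q1] -> dense [set g | ~ has_config g].
Proof.
move=> p1n U [g Ug] oU.
have [[T [nT ndT cfT]]|ng] := pselect (has_config g); last by exists g.
have [K [e [e0 KU]]] := nbhs_Ckball (open_nbhs_nbhs (conj oU Ug)).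
have [h [gh hgood]] := perturb_away_configs K k1 p1n ndT e0.
exists h; split; first exact: KU.
move=> [tau [ntau _ cf]]; apply: (hgood tau) => // a.
rewrite -(subrKA (c a)); apply: (le_trans (ler_normD _ _)).
have -> : radius m k = radius m k / 2 + radius m k / 2 by field.
by apply: lerD => //; rewrite distrC.
Qed.

End Configurations.
End GenericTables.

Section Residual.
Context {R : realType}.
Local Opaque derive1 det2.

(** The combinatorial type of a system, the rational centre of a box and the
    bound k (shifted by one) on the nondegeneracy. *)
Definition config_index := {m : nat & ({ffun 'I_m -> 'I_m} * {ffun 'I_m -> 'I_m} *
  'I_m * 'I_m * 'I_m * {ffun 'I_m -> rat} * nat)%type}.

Definition avoids (x : config_index) : set (table R) :=
  let: existT m (p, q, a0, p1, q1, c, k) := x in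
  [set g | p1 \notin [:: p a0; q a0; q1] ->
    ~ has_config k.+1%:R p q a0 p1 q1 (fun a => ratr (c a)) g].

Lemma avoids_open_dense (x : config_index) : open (avoids x) /\ dense (avoids x).
Proof.
case: x => m [[[[[[p q] a0] p1] q1] c] k] /=.
have k1 : 1 <= k.+1%:R :> R by rewrite ler1n.
have [p1n|p1n] := boolP (p1 \notin [:: p a0; q a0; q1]); last first.
  have -> : [set g | false -> ~ has_config k.+1%:R p q a0 p1 q1 (fun a => ratr (c a)) g] =
      [set: table R] by apply/seteqP; split=> // g _ h; discriminate h.
  split; first exact: openT.
  by move=> U [g Ug] _; exists g.
have -> : [set g | true -> ~ has_config k.+1%:R p q a0 p1 q1 (fun a => ratr (c a)) g] =
    [set g : table R | ~ has_config k.+1%:R p q a0 p1 q1 (fun a => ratr (c a)) g].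
  by apply/seteqP; split=> [g h|g h _]; [exact: (h isT)|exact: h].
split; first exact: no_config_open.
exact: no_config_dense.
Qed.

Definition generic_tables : set (table R) := \bigcap_(x : config_index) avoids x.

Lemma generic_residual : residual generic_tables.
Proof.
exists (fun n => if unpickle n is Some x then avoids x else setT); split=> [n|g Gg x _].
  case: (unpickle n) => [x|]; first exact: avoids_open_dense.
  by split; [exact: openT|move=> U [g Ug] _; exists g].
by have := Gg (pickle x) I; rewrite pickleK.
Qed.

Lemma cos_lt1 (t : R) : t != 0 -> `|t| < 2 * pi -> cos t < 1.
Proof.
move=> t0 t2; have E : cos t = 1 - sin (`|t| / 2) ^+ 2 *+ 2.
  have -> : cos t = cos (`|t| / 2 *+ 2).
    rewrite -mulr_natr divfK ?pnatr_eq0//.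
    by have [h|h] := leP 0 t; [rewrite ger0_norm|rewrite ltr0_norm// cosN].
  by rewrite cos_mulr2n cos2sin2; ring.
rewrite E ltrBlDr ltrDl pmulrn_lgt0// exprn_gt0// sin_gt0_pi// divr_gt0 ?normr_gt0//=.
by rewrite ltr_pdivrMr// mulrC.
Qed.

(** Number the elements of A to obtain a system of m + 1 equations for the m
    elements of A, and choose k and the centre of the box so that this solution
    is k-nondegenerate and lies in the box. *)
Lemma generic_not_overdetermined (g : table R) (A : seq R) :
  generic_tables g -> ~ overdetermined g A.
Proof.
move=> gen [x0 [y0 [z0 [y1 [z1 [[uA cA] memA [yz0 y1n] [r0 r1] rA]]]]]].
pose m := size A; pose tau (a : 'I_m) : R := nth 0 A a.
have tauP x : x \in A -> exists a, tau a = x.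
  move=> xA; have h : (index x A < m)%N by rewrite index_mem.
  by exists (Ordinal h); rewrite /tau /= nth_index.
have tauA a : tau a \in A by rewrite mem_nth.
have tau_inj a b : tau a = tau b -> a = b.
  by move=> /eqP; rewrite nth_uniq// => /eqP/val_inj.
move: memA => /= /and5P[x0A y0A z0A y1A /andP[z1A _]].
have [a0 a0E] := tauP _ x0A; have [p0 p0E] := tauP _ y0A; have [q0 q0E] := tauP _ z0A.
have [p1 p1E] := tauP _ y1A; have [q1 q1E] := tauP _ z1A.
subst x0 y0 z0 y1 z1.
(* Every parameter carries one chord; at a0 it is the prescribed first one. *)
have chordP (a : 'I_m) : exists pq : 'I_m * 'I_m,
    [/\ tau pq.1 <> tau pq.2, reflects g (tau a) (tau pq.1) (tau pq.2) & a = a0 -> pq = (p0, q0)].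
  have [->|na] := eqVneq a a0; first by exists (p0, q0).
  have [y [z [yA zA yz ryz]]] := rA _ (tauA a).
  have [b bE] := tauP _ yA; have [b' b'E] := tauP _ zA.
  exists (b, b'); rewrite bE b'E; split=> //.
  by move=> aa0; rewrite aa0 eqxx in na.
have [pq pqP] := choice chordP.
pose p : {ffun 'I_m -> 'I_m} := [ffun a => (pq a).1].
pose q : {ffun 'I_m -> 'I_m} := [ffun a => (pq a).2].
have pE a : p a = (pq a).1 by rewrite ffunE.
have qE a : q a = (pq a).2 by rewrite ffunE.
have p0q0 : p a0 = p0 /\ q a0 = q0 by rewrite pE qE; have [_ _ ->] := pqP a0.
have p1_notin : p1 \notin [:: p a0; q a0; q1].
  move: y1n; rewrite !inE; case: p0q0 => -> ->; apply: contra.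
  by case/or3P => /eqP ->; rewrite eqxx ?orbT.
have conf : config g p q a0 p1 q1 tau.
  split=> [a|]; first by rewrite pE qE; have [_ r _] := pqP a; exact: r.
  case: p0q0 => -> ->.
  have [c0 ->] := det2_colinear (table_regular (tableP g) (tau a0)) r0.
  have [c1 ->] := det2_colinear (table_regular (tableP g) (tau a0)) r1.
  by rewrite det2Zl det2Zr det2vv !mulr0.
have cos_pos a b : b != a -> 0 < 1 - cos (tau a - tau b).
  move=> ba; rewrite subr_gt0; apply: cos_lt1.
    by rewrite subr_eq0; apply: contra ba => /eqP/tau_inj ->.
  have := cA _ (tauA a); have := cA _ (tauA b); rewrite /circle /= !in_itv /=.
  by move=> /andP[b1 b2] /andP[a1 a2]; clear -a1 a2 b1 b2; rewrite ltr_norml; lra.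
have chord_pos a : 0 < `|g (tau (q a)) - g (tau (p a))|.
  rewrite normr_gt0 subr_eq0; apply/eqP => E; have [+ _ _] := pqP a; apply.
  by apply: (table_injective (tableP g)); rewrite ?inE; [exact: cA|exact: cA|rewrite -pE -qE].
have [M0 M00 M0P] := closed_bounded 0 (table_closed g).
have [M1 M10 M1P] := closed_bounded 1 (table_closed g).
(* k exceeds the inverse of each of the finitely many positive numbers that a
   k-nondegenerate system keeps away from 0. *)
pose X1 := \sum_a \sum_(b | b != a) (1 - cos (tau a - tau b))^-1.
pose X2 := \sum_a (`|g (tau (q a)) - g (tau (p a))|)^-1.
have X10 : 0 <= X1.
  by apply: sumr_ge0 => a _; apply: sumr_ge0 => b ba; rewrite invr_ge0 ltW// cos_pos.
have X20 : 0 <= X2 by apply: sumr_ge0 => a _; rewrite invr_ge0 ltW.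
pose X := M0 + M1 + X1 + X2.
have X0 : 0 <= X by rewrite /X; clear -M00 M10 X10 X20; lra.
pose k := Num.bound X.
have Xk : X <= k.+1%:R.
  by apply: ltW; apply: (lt_le_trans (archi_boundP X0)); rewrite ler_nat leqW.
have k0 : 0 < k.+1%:R :> R by rewrite ltr0n.
have inv_le (y : R) : 0 < y -> y^-1 <= X -> k.+1%:R^-1 <= y.
  by move=> y0 yX; rewrite -[y]invrK lef_pV2 ?posrE ?invr_gt0//; exact: le_trans Xk.
have nd : nondegenerate k.+1%:R g p q tau.
  split.
  - move=> t; split.
      by apply: (le_trans (M0P t)); apply: le_trans Xk; rewrite /X; clear -M10 X10 X20; lra.
    by apply: (le_trans (M1P t)); apply: le_trans Xk; rewrite /X; clear -M00 X10 X20; lra.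
  - move=> a b ba; apply: inv_le; first exact: cos_pos.
    apply: (@le_trans _ _ X1); last by rewrite /X; clear -M00 M10 X20; lra.
    rewrite /X1 (bigD1 a)//= (bigD1 b)//= -addrA lerDl addr_ge0//.
      by apply: sumr_ge0 => b' /andP[b'a _]; rewrite invr_ge0 ltW// cos_pos.
    by apply: sumr_ge0 => a' _; apply: sumr_ge0 => b' b'a; rewrite invr_ge0 ltW// cos_pos.
  - move=> a; apply: inv_le; first exact: chord_pos.
    apply: (@le_trans _ _ X2); last by rewrite /X; clear -M00 M10 X10; lra.
    by rewrite /X2 (bigD1 a)//= lerDl; apply: sumr_ge0 => a' _; rewrite invr_ge0 ltW.
have d0 : 0 < radius m (k.+1%:R : R) by case: (@radiusP R m k.+1%:R _) => //; rewrite ler1n.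
have ratP (a : 'I_m) : exists c : rat, `|tau a - ratr c| <= radius m (k.+1%:R : R) / 2.
  move: (radius _ _) d0 => d d0.
  have lt_d : tau a - d / 2 < tau a + d / 2 by lra.
  have [c] := rat_in_itvoo lt_d.
  by rewrite in_itv /= => /andP[c1 c2]; exists c; rewrite ler_norml; lra.
have [c cP] := choice ratP.
have := gen (existT _ m (p, q, a0, p1, q1, [ffun a => c a], k)) I.
by move=> /(_ p1_notin); apply; exists tau; split=> // a; rewrite ffunE.
Qed.

End Residual.

Theorem theoremA (R : realType) :
  (exists T1 : set (table R), residual T1 /\
    forall g : table R, T1 g ->
    forall O : R * R, (region g)° O ->
    forall (n : nat) (p : nat -> R * R), periodic_orbit g O n p ->
    forall i j : nat, (i < n)%N -> (j < n)%N -> i <> j ->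
      g (p i).1 <> g (p j).1)
  /\
  (exists T2 : set (table R), residual T2 /\
    forall g : table R, T2 g ->
    forall O : R * R, (region g)° O ->
    forall (n m : nat) (p q : nat -> R * R),
    periodic_orbit g O n p -> periodic_orbit g O m q ->
    orbit_set n p <> orbit_set m q ->
    forall i j : nat, (i < n)%N -> (j < m)%N ->
      g (p i).1 <> g (q j).1).
Proof.
have same_parameter g O n m (p q : nat -> R * R) i j :
    periodic_orbit g O n p -> periodic_orbit g O m q -> (i < n)%N -> (j < m)%N ->
    g (p i).1 = g (q j).1 -> (p i).1 = (q j).1.
  move=> op oq in_ jm; apply: (table_injective (tableP g)); rewrite inE.
    by case: (orbit_phase op in_).
  by case: (orbit_phase oq jm).
split; exists generic_tables; split; try exact: generic_residual.
- move=> g gen O _ n p op i j in_ jn ij gij.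
  have Es := same_parameter _ _ _ _ _ _ _ _ op op in_ jn gij.
  have pij : p i <> p j.
    have [lt|lt|//] := ltngtP i j; first exact: orbit_states_distinct op lt jn.
    by move=> E; exact: (orbit_states_distinct op lt in_ (esym E)).
  have [A oA] := crossing_overdetermined op op in_ jn Es pij.
  exact: generic_not_overdetermined gen oA.
- move=> g gen O _ n m p q op oq npq i j in_ jm gij.
  have Es := same_parameter _ _ _ _ _ _ _ _ op oq in_ jm gij.
  have pij : p i <> q j.
    move=> E; apply: npq; apply/seteqP; split; first exact: orbit_set_sub op oq in_ jm E.
    exact: orbit_set_sub oq op jm in_ (esym E).
  have [A oA] := crossing_overdetermined op oq in_ jm Es pij.
  exact: generic_not_overdetermined gen oA.
Qed.
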